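(* There exists a minimal, uniquely ergodic $4$-IET with exactly two flips. In particular, $\mathcal{I}(4,2)\neq\emptyset$ and $\mathcal{C}(3,2)\neq\emptyset$.
   Context: An $n$-IET of $[0,\ell]$ is given by a partition $0=a_0<a_1<\dots<a_n=\ell$, $I_i=(a_{i-1},a_i)$, and an injective map $T:\bigcup I_i\to[0,\ell]$ which is an isometry on each $I_i$ and cannot be continuously extended to a larger open set. Similarly an $n$-CET is defined on $S^1=[0,1]/(0\sim1)$ with $n$ pairwise disjoint open subintervals whose closures cover $S^1$ and the same conditions. A flip is a subinterval on which $T$ reverses orientation. The orbit of $p$ is $\{T^m(p):m\in\mathbb{Z},\ p\in\mathrm{Dom}(T^m)\}$; $T$ is transitive if some orbit is dense, and minimal if it is transitive and has no finite orbits (points outside $\mathrm{Dom}(T)\cup\mathrm{Dom}(T^{-1})$ count as having finite orbit $\{p\}$). $T$ is uniquely ergodic if Lebesgue measure is, up to scalar multiple, the only $T$-invariant Borel measure. $\mathcal{I}(n,f)$ (resp. $\mathcal{C}(n,f)$) denotes the set of transitive IETs (resp. CETs) of $n$ subintervals with exactly $f$ flips.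
   Formalization: Minimality requires no finite orbits only for points of the open interval (0,ℓ), as 0 and ℓ are never in Dom(T)∪Dom(T⁻¹) and would make no IET minimal; unique ergodicity ranges over finite Borel measures, since infinite orbit-counting measures are also invariant. *)

(* Defs.v *)
From HB Require Import structures.
From mathcomp Require Import all_boot all_order all_algebra.
From mathcomp Require Import all_classical all_reals all_analysis.
Set Implicit Arguments. Unset Strict Implicit. Unset Printing Implicit Defensive.
Import Order.TTheory GRing.Theory Num.Theory.
Import numFieldNormedType.Exports.
Local Open Scope classical_set_scope.
Local Open Scope ring_scope.

Section Defs.
Variable R : realType.

Definition in_dom_iter (D : set R) (T : R -> R) (m : nat) (p : R) : Prop :=
  forall k, (k < m)%N -> D (iter k T p).

Definition orbit (D : set R) (T : R -> R) (p : R) : set R :=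
  [set x | exists m : nat, in_dom_iter D T m p /\ x = iter m T p] `|`
  [set q | exists m : nat, in_dom_iter D T m q /\ iter m T q = p].

Definition iet_piece (a : nat -> R) (i : nat) : set R := `]a i, a i.+1[.

Definition iet_dom (n : nat) (a : nat -> R) : set R :=
  \bigcup_(i in [set i | (i < n)%N]) iet_piece a i.

Definition is_IET (n : nat) (l : R) (a : nat -> R) (T : R -> R) : Prop :=
  [/\ a 0%N = 0 /\ a n = l /\
      (forall i, (i < n)%N -> a i < a i.+1),
      (forall x, iet_dom n a x -> T x \in `[0, l]),
      (forall i, (i < n)%N -> forall x y, iet_piece a i x -> iet_piece a i y ->
          `|T x - T y| = `|x - y|),
      {in iet_dom n a &, injective T} &
      ~ (exists (U : set R) (g : R -> R),
           [/\ open U, U `<=` `[0, l], iet_dom n a `<` U,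
               {within U, continuous g} & {in iet_dom n a, g =1 T}])].

Definition iet_flip (a : nat -> R) (T : R -> R) (i : nat) : Prop :=
  forall x y, iet_piece a i x -> iet_piece a i y -> x < y -> T y < T x.

Definition iet_nflips (n : nat) (a : nat -> R) (T : R -> R) : nat :=
  #|[set i : 'I_n | `[< iet_flip a T i >]]|%N.

Definition iet_transitive (n : nat) (l : R) (a : nat -> R) (T : R -> R) : Prop :=
  exists p, p \in `[0, l] /\ `[0, l] `<=` closure (orbit (iet_dom n a) T p).

Definition iet_minimal (n : nat) (l : R) (a : nat -> R) (T : R -> R) : Prop :=
  iet_transitive n l a T /\
  forall p, p \in `]0, l[ -> ~ finite_set (orbit (iet_dom n a) T p).

Definition iet_invariant (n : nat) (l : R) (a : nat -> R) (T : R -> R)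
    (mu : set (measurableTypeR R) -> \bar R) : Prop :=
  forall A : set (measurableTypeR R), measurable A ->
    mu (iet_dom n a `&` T @^-1` A) = mu A.

Definition leb_on (l : R) (A : set (measurableTypeR R)) : \bar R :=
  lebesgue_measure (A `&` `[0, l]).

Definition iet_uniquely_ergodic (n : nat) (l : R) (a : nat -> R) (T : R -> R)
    : Prop :=
  iet_invariant n l a T (leb_on l) /\
  forall mu : {measure set (measurableTypeR R) -> \bar R},
    (mu setT < +oo)%E -> mu (~` `[0, l]) = 0%E ->
    iet_invariant n l a T mu ->
    exists c : R, 0 <= c /\
      forall A, measurable A -> mu A = (c%:E * leb_on l A)%E.

Definition IET_class (n f : nat) : Prop :=
  exists (l : R) (a : nat -> R) (T : R -> R),
    [/\ is_IET n l a T, iet_nflips n a T = f & iet_transitive n l a T].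

(* Points of S^1 are represented by reals in [0, 1). *)

Definition frac (x : R) : R := x - (Num.floor x)%:~R.

Definition cdist (x y : R) : R := Num.min (frac (x - y)) (frac (y - x)).

Definition circle : set R := `[0, 1[.

(* Breakpoints b_0 < b_1 < ... < b_n = b_0 + 1 with 0 <= b_0 < 1;
   the i-th arc (i < n) is the image of (b_i, b_(i+1)) in S^1. *)
Definition cet_piece (b : nat -> R) (i : nat) : set R :=
  [set x | circle x /\ exists k : int, b i < x + k%:~R < b i.+1].

Definition cet_dom (n : nat) (b : nat -> R) : set R :=
  \bigcup_(i in [set i | (i < n)%N]) cet_piece b i.

Definition circ_open (U : set R) : Prop :=
  U `<=` circle /\
  forall x, U x -> exists2 d : R, 0 < d &
    forall y, circle y -> cdist x y < d -> U y.

Definition circ_continuous_on (U : set R) (g : R -> R) : Prop :=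
  forall x, U x -> forall e : R, 0 < e -> exists2 d : R, 0 < d &
    forall y, U y -> cdist x y < d -> cdist (g x) (g y) < e.

Definition is_CET (n : nat) (b : nat -> R) (T : R -> R) : Prop :=
  [/\ [/\ 0 <= b 0%N, b 0%N < 1, b n = b 0%N + 1 &
      (forall i, (i < n)%N -> b i < b i.+1)],
      (forall x, cet_dom n b x -> circle (T x)),
      (forall i, (i < n)%N -> forall x y, cet_piece b i x -> cet_piece b i y ->
          cdist (T x) (T y) = cdist x y),
      {in cet_dom n b &, injective T} &
      ~ (exists (U : set R) (g : R -> R),
           [/\ circ_open U, cet_dom n b `<` U,
               (forall x, U x -> circle (g x)),
               circ_continuous_on U g & {in cet_dom n b, g =1 T}])].

(* T reverses orientation on the i-th arc: going forward by s - t along the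
   arc, the image moves backward by s - t. *)
Definition cet_flip (b : nat -> R) (T : R -> R) (i : nat) : Prop :=
  forall t s, b i < t -> t < s -> s < b i.+1 ->
    frac (T (frac t) - T (frac s)) = s - t.

Definition cet_nflips (n : nat) (b : nat -> R) (T : R -> R) : nat :=
  #|[set i : 'I_n | `[< cet_flip b T i >]]|%N.

Definition cet_transitive (n : nat) (b : nat -> R) (T : R -> R) : Prop :=
  exists p, circle p /\
    forall x, circle x -> forall e : R, 0 < e ->
      exists2 y, orbit (cet_dom n b) T p y & cdist x y < e.

Definition CET_class (n f : nat) : Prop :=
  exists (b : nat -> R) (T : R -> R),
    [/\ is_CET n b T, cet_nflips n b T = f & cet_transitive n b T].

End Defs.

(* Main.v *)
(* The exchange is self-similar. Its pieces, of lengths p, m, q, q with the last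
   two flipped, are such that the first return map to a segment J is conjugate to
   the whole map T by the orientation-reversing similarity h of ratio m, where
   m^3 + 2 m^2 + 2 m = 1. The towers over the four pieces of J have 11 floors.
   - Since h permutes (up to one step of T) the discontinuities of T^-1, none of
     them ever meets a breakpoint, so T has no connection; moreover the orbit of
     such a point visits every floor of the towers of every order, so it is dense.
     T being a local isometry, a periodic point would then contradict density.
   - If the increments of G on intervals are T-invariant, so are those of -G o h
     (this applies to the distribution functions of invariant measures). The increments of G on the pieces are thus in the image of every
     power of the incidence matrix, hence proportional to the lengths by a
     Perron-Frobenius contraction; applied at all scales this makes G linear.
   - On the circle T is continuous at the breakpoint p, so the first two pieces
     merge and a 3-CET is left. *)
Require Import Defs.
From HB Require Import structures.
From mathcomp Require Import all_boot all_order all_algebra.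
From mathcomp Require Import all_classical all_reals all_analysis measurable_realfun.
From mathcomp Require Import zify ring lra.

Set Implicit Arguments. Unset Strict Implicit. Unset Printing Implicit Defensive.
Import Order.TTheory GRing.Theory Num.Theory.
Import numFieldNormedType.Exports.
Local Open Scope classical_set_scope.
Local Open Scope ring_scope.

(** * Orbits of partially defined maps *)

Section PartialOrbits.
Variables (R : realType) (D : set R) (T : R -> R).

Definition reach (x y : R) : Prop :=
  exists n, in_dom_iter D T n x /\ y = iter n T x.

Lemma in_dom_iterS n x :
  in_dom_iter D T n.+1 x <-> D x /\ in_dom_iter D T n (T x).
Proof.
split=> [Dx | [Dx DTx] [|k]] //; last by rewrite ltnS iterSr; exact: DTx.
by split=> [|k kn]; [exact: (Dx 0%N) | rewrite -iterSr; exact: Dx].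
Qed.

Lemma in_dom_iterW n k x : (n <= k)%N ->
  in_dom_iter D T k x -> in_dom_iter D T n x.
Proof. by move=> nk Dx i iN; apply: Dx; exact: leq_trans nk. Qed.

Lemma in_dom_iterD n k x :
  in_dom_iter D T (n + k) x <->
  in_dom_iter D T n x /\ in_dom_iter D T k (iter n T x).
Proof.
elim: n x => [|n IH] x; first by split=> [|[]].
rewrite addSn !in_dom_iterS iterSr IH.
by split=> [[? []]|[[]]].
Qed.

Lemma reach_refl x : reach x x.
Proof. by exists 0%N. Qed.

Lemma reach_step x y : D x -> reach (T x) y -> reach x y.
Proof.
by move=> Dx [n [nx ->]]; exists n.+1; rewrite in_dom_iterS iterSr.
Qed.

Lemma reach_trans y x z : reach x y -> reach y z -> reach x z.
Proof.
move=> [n [nx ->]] [k [kx ->]]; exists (n + k)%N.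
by rewrite in_dom_iterD addnC iterD.
Qed.

Lemma reach_orbit x y : reach x y -> Defs.orbit D T x y.
Proof. by move=> [n [nx ->]]; left; exists n. Qed.

End PartialOrbits.

Lemma pigeonhole_set (U : eqType) (A : set U) (f : nat -> U) :
  finite_set A -> (forall n, A (f n)) ->
  exists i j, (i < j)%N /\ f i = f j.
Proof.
move=> /finite_seqP[s ->] Af; apply: contrapT => nf.
have /uniq_leq_size : uniq (map f (iota 0 (size s).+1)).
  rewrite map_inj_in_uniq ?iota_uniq // => i j _ _ fij.
  apply/eqP; case: ltngtP => // ij; exfalso; apply: nf.
    by exists i, j.
  by exists j, i.
move=> /(_ s); rewrite size_map size_iota ltnn => sub; suff : false by [].
apply: sub.
by move=> _ /mapP[i _ ->]; exact: Af.
Qed.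

(** * Measures on the line, geometric bounds, distance on the circle *)

Section RealGeneralities.
Variable R : realType.
Local Notation RT := (measurableTypeR R).

Lemma measurable_affine (s t : R) :
  measurable_fun setT (fun x : RT => s * x + t : RT).
Proof.
by apply: measurable_funD => //; apply: measurable_funM => //; exact: measurable_cst.
Qed.

Lemma measurable_affine_preimage (s t : R) (A : set RT) : measurable A ->
  measurable ((fun x : RT => s * x + t : RT) @^-1` A).
Proof. by move=> mA; rewrite -[X in measurable X]setTI; exact: measurable_affine. Qed.

(** The hypothesis [s * s = 1] covers translations and reflections at once. The pushforward gives
    half-open intervals their length, so uniqueness of Lebesgue measure applies. *)
Lemma lebesgue_measure_isometry (s t : R) (A : set RT) : s * s = 1 -> measurable A ->
  lebesgue_measure ((fun x : RT => s * x + t : RT) @^-1` A) = lebesgue_measure A.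
Proof.
move=> s1 mA; have mf := measurable_affine s t.
apply/esym/(@lebesgue_measure_unique R (pushforward lebesgue_measure _)) => // _ [[a b]] _ <-.
rewrite -[RHS]/(lebesgue_measure ((fun x : RT => s * x + t : RT) @^-1` `]a, b]%classic)).
have /orP[/eqP sE|/eqP sE] : (s == 1) || (s == - 1).
  by rewrite -subr_eq0 -[s == -1]subr_eq0 opprK -mulf_eq0; apply/eqP; lra.
- have -> : (fun x : RT => s * x + t : RT) @^-1` `]a, b]%classic = `]a - t, b - t]%classic.
    by apply/seteqP; split=> x /=; rewrite !in_itv /= sE; lra.
  rewrite !lebesgue_measure_itv /= !lte_fin ltrD2r; case: ifP => // _.
  by rewrite -!EFinB; congr EFin; ring.
have -> : (fun x : RT => s * x + t : RT) @^-1` `]a, b]%classic = `[t - b, t - a[%classic.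
  by apply/seteqP; split=> x /=; rewrite !in_itv /= sE; lra.
rewrite !lebesgue_measure_itv /= !lte_fin ltrD2l ltrN2; case: ifP => // _.
by rewrite -!EFinB; congr EFin; ring.
Qed.

(** Half-open intervals are closed under intersection and generate the Borel sets, and the intervals
    []-n, n]] exhaust the line with finite mass. *)
Lemma finite_measure_ext (m1 m2 : {measure set RT -> \bar R}) :
  (m1 setT < +oo)%E ->
  (forall a b : R, a < b -> m1 `]a, b]%classic = m2 `]a, b]%classic) ->
  forall A, measurable A -> m1 A = m2 A.
Proof.
move=> fin eq_itv A mA.
have eq_gen X : ocitv X -> m1 X = m2 X.
  by move=> /ocitvP[->|[[a b] /= ab ->]]; rewrite ?measure0// eq_itv.
have cover : \bigcup_n (`](- n%:R), n%:R]%classic : set RT) = setT.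
  rewrite -subTset => /= x _.
  exists (Num.bound `|x|) => //=; have := archi_boundP (normr_ge0 x).
  by rewrite in_itv /= ltr_norml => /andP[-> /ltW].
have lt_oo n : (m1 (`](- n%:R)%R, n%:R%R]%classic : set RT) < +oo)%E.
  apply: le_lt_trans fin; apply: le_measure; rewrite ?inE//.
exact: (@measure_unique _ R RT (@ocitv R)
  (fun n : nat => `](- n%:R), n%:R]%classic) erefl (@ocitvI R)
  (fun n => is_ocitv _ _) cover m1 m2 eq_gen lt_oo A mA).
Qed.

Lemma geometric_le0 (x c y : R) : 0 <= x < 1 ->
  (forall n, y <= x ^+ n * c) -> y <= 0.
Proof.
move=> /andP[x0 x1] le_y; rewrite leNgt; apply/negP => y0.
have cv : x ^+ n * c @[n --> \oo] --> (0 : R).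
  by rewrite -(mul0r c); apply: cvgMl; apply: cvg_expr; rewrite ger0_norm.
move/cvgrPdist_lt: cv => /(_ _ y0)[n _ /(_ n (leqnn n))] /=.
by rewrite sub0r normrN ltNge (le_trans (le_y n) (ler_norm _)).
Qed.

Lemma itv_infinite a b : a < b -> ~ finite_set [set x : R | a < x < b].
Proof.
move=> ab fin.
have [n|i [j [ij]]] := pigeonhole_set (f := fun n => a + (b - a) / n.+2%:R) fin.
  have n0 : 0 < n.+2%:R :> R by [].
  have nb : (b - a) / n.+2%:R < b - a.
    by rewrite ltr_pdivrMr// -[ltLHS]mulr1 ltr_pM2l ?subr_gt0// ltr1n.
  have na : 0 < (b - a) / n.+2%:R by rewrite divr_gt0 ?subr_gt0.
  by move: nb na; rewrite /=; move: (_ / _) => t; lra.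
have ba : b - a != 0 by rewrite subr_eq0 gt_eqF.
move=> /addrI /(mulfI ba) /invr_inj /eqP; rewrite eqr_nat => /eqP[ijE].
by rewrite ijE ltnn in ij.
Qed.

Lemma frac_small (x : R) : 0 <= x < 1 -> Defs.frac x = x.
Proof.
by move=> x01; rewrite /Defs.frac (@floor_def _ x 0) ?subr0// add0r.
Qed.

Lemma fracDz (x : R) (k : int) : Defs.frac (x + k%:~R) = Defs.frac x.
Proof. by rewrite /Defs.frac floorDrz ?intrKfloor ?rmorphD/=; [ring|]. Qed.

Lemma frac_sub (x y : R) : Defs.frac (Defs.frac x - Defs.frac y) = Defs.frac (x - y).
Proof.
rewrite -[RHS](fracDz _ (Num.floor y - Num.floor x)); congr Defs.frac.
by rewrite /Defs.frac rmorphB /=; ring.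
Qed.

Lemma cdist_frac (x y : R) : cdist (Defs.frac x) (Defs.frac y) = cdist x y.
Proof. by rewrite /cdist !frac_sub. Qed.

Lemma cdistC (x y : R) : cdist x y = cdist y x.
Proof. by rewrite /cdist minC. Qed.

Lemma cdist_lt (x y e : R) : cdist x y < e -> exists k : int, `|x - y + k%:~R| < e.
Proof.
have frac_lt u : Defs.frac u < e -> exists k : int, `|u + k%:~R| < e.
  exists (- Num.floor u); rewrite rmorphN /= ger0_norm//.
  by rewrite subr_ge0 floor_le.
rewrite /cdist gt_min => /orP[/frac_lt//|/frac_lt[k kP]].
by exists (- k); rewrite -normrN rmorphN /= opprD opprK opprB.
Qed.

Lemma cdist_le (x y : R) : `|x - y| < 1 -> cdist x y <= `|x - y|.
Proof.
move=> xy1; rewrite /cdist ge_min; have [yx|xy] := lerP y x.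
  have d0 : 0 <= x - y by rewrite subr_ge0.
  by rewrite ger0_norm// in xy1 *; rewrite frac_small ?lexx// d0.
have d0 : x - y < 0 by rewrite subr_lt0.
rewrite ltr0_norm// opprB in xy1 *.
by rewrite (@frac_small (y - x)) ?lexx ?orbT// xy1 subr_ge0 ltW.
Qed.

End RealGeneralities.

(** * The self-similar exchange *)

Section Example.
Variables (R : realType) (m p q : R).
(* These relations say that the lengths (p, m, q, q) of the four pieces form an
   eigenvector, for the eigenvalue m^-1, of the incidence matrix of the towers. *)
Hypotheses (m0 : 0 < m) (mm0 : 0 < m * m) (mp0 : 0 < m * p) (mq0 : 0 < m * q).
Hypotheses (pE : p = m * m + 2 * (m * q)) (qE : q = m * m + m * q).
Hypothesis mE : m = m * p + m * m + 2 * (m * q).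
Hypothesis sumE : p + m + 2 * q = 1.

Definition brk (i : nat) : R :=
  match i with 0 => 0 | 1 => p | 2 => p + m | 3 => p + m + q | _ => 1 end.

(** On the circle [p] is interior to an arc; the half-open cases give [T p = 0], the value that
    makes [T] continuous there. *)
Definition T (x : R) : R :=
  if x < p then x + (1 - p) else if x < p + m then x - p
  else if x < p + m + q then p + 2 * m + q - x else p + 2 * m + 3 * q - x.

Definition h (x : R) : R := q + m - m * x.

(** Linear arithmetic suffices because the hypotheses treat the products [m * m], [m * p] and
    [m * q] as atoms. *)
Ltac lin := move: m0 mm0 mp0 mq0 pE qE mE sumE; lra.

Local Notation D := (iet_dom 4 brk).
Local Notation op i x := (brk i < x < brk i.+1).
Local Notation cp i x := (brk i <= x <= brk i.+1).

Lemma iet_pieceE i x : iet_piece brk i x = op i x.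
Proof. by rewrite /iet_piece /= in_itv. Qed.

Lemma domI i x : (i < 4)%N -> op i x -> D x.
Proof. by move=> i4 ix; exists i => //; rewrite iet_pieceE. Qed.

Lemma domP x : D x -> exists2 i, (i < 4)%N & op i x.
Proof. by move=> [i i4]; rewrite iet_pieceE; exists i. Qed.

Lemma dom4 x : D x ->
  [\/ 0 < x < p, p < x < p + m, p + m < x < p + m + q | p + m + q < x < 1].
Proof.
move=> /domP[[|[|[|[|//]]]] _ /= ix]; [exact: Or41|exact: Or42|exact: Or43|exact: Or44].
Qed.

Lemma T0 (x : R) : 0 <= x < p -> T x = x + (1 - p).
Proof. by move=> ix; rewrite /T; do ![case: ltrP => ?]; lin. Qed.

Lemma T1 (x : R) : p <= x < p + m -> T x = x - p.
Proof. by move=> ix; rewrite /T; do ![case: ltrP => ?]; lin. Qed.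

Lemma T2 (x : R) : p + m <= x < p + m + q -> T x = p + 2 * m + q - x.
Proof. by move=> ix; rewrite /T; do ![case: ltrP => ?]; lin. Qed.

Lemma T3 (x : R) : p + m + q <= x -> T x = p + 2 * m + 3 * q - x.
Proof. by move=> ix; rewrite /T !ifF //; lin. Qed.

Lemma domT x : D x ->
  [\/ 0 < x < p /\ T x = x + (1 - p), p < x < p + m /\ T x = x - p,
      p + m < x < p + m + q /\ T x = p + 2 * m + q - x
    | p + m + q < x < 1 /\ T x = p + 2 * m + 3 * q - x].
Proof.
case/dom4=> ix.
- by apply: Or41; split=> //; apply: T0; lin.
- by apply: Or42; split=> //; apply: T1; lin.
- by apply: Or43; split=> //; apply: T2; lin.
- by apply: Or44; split=> //; apply: T3; lin.
Qed.

Lemma T_itv x : D x -> 0 < T x < 1.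
Proof. by case/domT=> -[ix ->]; lin. Qed.

Lemma dom_itv x : D x -> 0 < x < 1.
Proof. by case/dom4; lin. Qed.

Lemma T_inj : {in D &, injective T}.
Proof.
move=> x y; rewrite !inE => /domT Dx /domT Dy.
by case: Dx => -[ix ->]; case: Dy => -[iy ->]; lin.
Qed.

Let mul_itv a b x : a < x < b -> m * a < m * x < m * b.
Proof. by rewrite !ltr_pM2l. Qed.

(** * Towers of the first return map *)

(* The image of h is the segment [q, q + m]; the four lemmas below follow its
   four subintervals h I_i until they return, which they do as h (T I_i). *)
Lemma tower0 x : op 0 x -> op 1 (h x) /\ T (h x) = h (T x).
Proof.
move=> /= ix; have := mul_itv ix => mx.
have h1 : p < h x < p + m by rewrite /h; lin.
by split=> //; rewrite (T0 (x := x)) ?(T1 (x := h x)) /h; lin.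
Qed.

Lemma tower1 x : op 1 x ->
  [/\ op 1 (h x), op 0 (h x - p), op 3 (h x + 1 - 2 * p), op 2 (m * x + 2 * p) &
    [/\ T (h x) = h x - p, T (h x - p) = h x + 1 - 2 * p,
      T (h x + 1 - 2 * p) = m * x + 2 * p & T (m * x + 2 * p) = h (T x)]].
Proof.
move=> /= ix; have := mul_itv ix => mx.
have h1 : p < h x < p + m by rewrite /h; lin.
have h2 : 0 < h x - p < p by rewrite /h; lin.
have h3 : p + m + q < h x + 1 - 2 * p < 1 by rewrite /h; lin.
have h4 : p + m < m * x + 2 * p < p + m + q by lin.
split=> //; rewrite (T0 (x := h x - p)) ?(T1 (x := h x)) ?(T1 (x := x))
  ?(T2 (x := m * x + 2 * p)) ?(T3 (x := h x + 1 - 2 * p)).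
by rewrite /h; split; lin.
all: lin.
Qed.

Lemma tower2 x : op 2 x ->
  [/\ op 1 (h x), op 0 (h x - p), op 2 (h x + 1 - 2 * p) &
    [/\ T (h x) = h x - p, T (h x - p) = h x + 1 - 2 * p &
      T (h x + 1 - 2 * p) = h (T x)]].
Proof.
move=> /= ix; have := mul_itv ix => mx.
have h1 : p < h x < p + m by rewrite /h; lin.
have h2 : 0 < h x - p < p by rewrite /h; lin.
have h3 : p + m < h x + 1 - 2 * p < p + m + q by rewrite /h; lin.
split=> //; rewrite (T0 (x := h x - p)) ?(T1 (x := h x)) ?(T2 (x := x)) ?T2.
by rewrite /h; split; lin.
all: lin.
Qed.

Lemma tower3 x : op 3 x ->
  [/\ op 0 (h x), op 3 (h x + 1 - p), op 1 (m * x + p) &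
    [/\ T (h x) = h x + 1 - p, T (h x + 1 - p) = m * x + p &
      T (m * x + p) = h (T x)]].
Proof.
move=> /= ix; have := mul_itv ix => mx.
have h1 : 0 < h x < p by rewrite /h; lin.
have h2 : p + m + q < h x + 1 - p < 1 by rewrite /h; lin.
have h3 : p < m * x + p < p + m by lin.
split=> //; rewrite (T0 (x := h x)) ?(T1 (x := m * x + p)) ?(T3 (x := x)) ?T3.
by rewrite /h; split; lin.
all: lin.
Qed.

Lemma reach_tower1 x : op 1 x ->
  [/\ reach D T (h x) (h x - p), reach D T (h x) (h x + 1 - 2 * p),
    reach D T (h x) (m * x + 2 * p) & reach D T (T (h x)) (h (T x))].
Proof.
move=> /tower1[h1 h2 h3 h4 [e1 e2 e3 e4]].
have r1 := reach_step (domI _ h1) (reach_refl D T (T (h x))).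
have r2 := reach_step (domI _ h2) (reach_refl D T (T (h x - p))).
have r3 := reach_step (domI _ h3) (reach_refl D T (T (h x + 1 - 2 * p))).
have r4 := reach_step (domI _ h4) (reach_refl D T (T (m * x + 2 * p))).
rewrite e1 e2 e3 e4 in r1 r2 r3 r4 *.
have r12 := reach_trans (r1 isT) (r2 isT).
split; [exact: r1|exact: r12|exact: reach_trans r12 (r3 isT)|].
exact: reach_trans (r2 isT) (reach_trans (r3 isT) (r4 isT)).
Qed.

Lemma reach_tower2 x : op 2 x ->
  [/\ reach D T (h x) (h x - p), reach D T (h x) (h x + 1 - 2 * p)
    & reach D T (T (h x)) (h (T x))].
Proof.
move=> /tower2[h1 h2 h3 [e1 e2 e3]].
have r1 := reach_step (domI _ h1) (reach_refl D T (T (h x))).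
have r2 := reach_step (domI _ h2) (reach_refl D T (T (h x - p))).
have r3 := reach_step (domI _ h3) (reach_refl D T (T (h x + 1 - 2 * p))).
rewrite e1 e2 e3 in r1 r2 r3 *.
split; [exact: r1|exact: reach_trans (r1 isT) (r2 isT)|].
exact: reach_trans (r2 isT) (r3 isT).
Qed.

Lemma reach_tower3 x : op 3 x ->
  [/\ reach D T (h x) (h x + 1 - p), reach D T (h x) (m * x + p)
    & reach D T (T (h x)) (h (T x))].
Proof.
move=> /tower3[h1 h2 h3 [e1 e2 e3]].
have r1 := reach_step (domI _ h1) (reach_refl D T (T (h x))).
have r2 := reach_step (domI _ h2) (reach_refl D T (T (h x + 1 - p))).
have r3 := reach_step (domI _ h3) (reach_refl D T (T (m * x + p))).
rewrite e1 e2 e3 in r1 r2 r3 *.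
split; [exact: r1|exact: reach_trans (r1 isT) (r2 isT)|].
exact: reach_trans (r2 isT) (r3 isT).
Qed.

(** Starting from [T (h x)] instead of [h x] records that the return takes at least one step of [T];
    [survive_h] counts iterates with it. *)
Lemma reach_tower x : D x ->
  reach D T (T (h x)) (h (T x)) /\ D (h x).
Proof.
case/domP=> -[|[|[|[|//]]]] _ ix.
- by have [h1 ->] := tower0 ix; split; [exact: reach_refl|exact: domI h1].
- by have [_ _ _ r] := reach_tower1 ix; have [/domI h1] := tower1 ix; split=> //; exact: h1.
- by have [_ _ r] := reach_tower2 ix; have [/domI h1] := tower2 ix; split=> //; exact: h1.
- by have [_ _ r] := reach_tower3 ix; have [/domI h1] := tower3 ix; split=> //; exact: h1.
Qed.

Lemma reach_h x y : reach D T x y -> reach D T (h x) (h y).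
Proof.
move=> [n [nx ->]]; elim: n x nx => [|n IH] x; first by move=> _; exact: reach_refl.
rewrite in_dom_iterS iterSr => -[Dx /IH hT].
have [rx Dhx] := reach_tower Dx.
exact/(reach_step Dhx)/(reach_trans rx).
Qed.

Lemma survive_h n x : in_dom_iter D T n x -> in_dom_iter D T n (h x).
Proof.
elim: n x => // n IH x; rewrite in_dom_iterS => -[Dx /IH nTx].
have [[k [kx e]] Dhx] := reach_tower Dx.
rewrite in_dom_iterS; split=> //.
by apply: (in_dom_iterW (leq_addl k n)); rewrite in_dom_iterD -e.
Qed.

Lemma hb2 : h (m + q) = m. Proof. by rewrite /h; lin. Qed.

Lemma b2_piece : op 1 (m + q). Proof. by rewrite /=; lin. Qed.

Lemma Tb2 : T (m + q) = h (m + 2 * q).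
Proof. by rewrite T1 /h; lin. Qed.

Lemma b3_piece : op 2 (m + 2 * q). Proof. by rewrite /=; lin. Qed.

Lemma Tb3 : T (m + 2 * q) = h m.
Proof. by rewrite T2 /h; lin. Qed.

(* The discontinuities m, m + q, m + 2 q of the inverse of T are permuted by
   the renormalization, so none of them ever falls on a breakpoint of T. *)
Lemma survive_images n :
  [/\ in_dom_iter D T n m, in_dom_iter D T n (m + q)
    & in_dom_iter D T n (m + 2 * q)].
Proof.
elim: n => [|n [n1 n2 n3]]; first by [].
(* [m = h (m + q)] gains no step of [T], so [m + q] has to reach [n.+1] first. *)
have D2 : in_dom_iter D T n.+1 (m + q).
  by apply/in_dom_iterS; rewrite Tb2; split; [exact: domI b2_piece|exact: survive_h].
split=> //; first by rewrite -hb2; exact: survive_h.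
by apply/in_dom_iterS; rewrite Tb3; split; [exact: domI b3_piece|exact: survive_h].
Qed.

(** * Density of the forward orbit of [m] *)

Definition visits (x d : R) : Prop :=
  forall i y, (i < 4)%N -> cp i y ->
    exists z, [/\ reach D T x z, op i z & `|z - y| <= d].

Lemma visits_T x d : D x -> visits (T x) d -> visits x d.
Proof.
move=> Dx vx i y i4 iy; have [z [rz iz zy]] := vx i y i4 iy.
by exists z; split=> //; exact: reach_step rz.
Qed.

(* floor i j c s: the map c + s m id sends the piece I_j onto a floor T^k h I_j,
   k < r_j, of the tower above h I_j, and that floor lies in I_i. *)
Inductive floor : nat -> nat -> R -> R -> Prop :=
| Floor02 : floor 0 2 (q + m - p) (- 1)
| Floor01 : floor 0 1 (q + m - p) (- 1)
| Floor03 : floor 0 3 (q + m) (- 1)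
| Floor12 : floor 1 2 (q + m) (- 1)
| Floor11 : floor 1 1 (q + m) (- 1)
| Floor10 : floor 1 0 (q + m) (- 1)
| Floor13 : floor 1 3 p 1
| Floor21 : floor 2 1 (2 * p) 1
| Floor22 : floor 2 2 (q + m + 1 - 2 * p) (- 1)
| Floor31 : floor 3 1 (q + m + 1 - 2 * p) (- 1)
| Floor33 : floor 3 3 (q + m + 1 - p) (- 1).

Lemma floor_lt i j c s : floor i j c s -> (j < 4)%N.
Proof. by case. Qed.

Lemma floor_sign i j c s : floor i j c s -> s * s = 1.
Proof. by case; ring. Qed.

Lemma floor_reach i j c s z : floor i j c s -> op j z ->
  reach D T (h z) (c + s * (m * z)) /\ op i (c + s * (m * z)).
Proof.
have rE k u v : u = v -> reach D T (h z) u /\ op k u ->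
  reach D T (h z) v /\ op k v by move=> ->.
case=> {i j c s} jz.
- have [_ w0 _ _] := tower2 jz; have [r _ _] := reach_tower2 jz.
  by apply: rE (conj r w0); rewrite /h; ring.
- have [_ w0 _ _ _] := tower1 jz; have [r _ _ _] := reach_tower1 jz.
  by apply: rE (conj r w0); rewrite /h; ring.
- have [w0 _ _ _] := tower3 jz.
  by apply: rE (conj (reach_refl _ _ _) w0); rewrite /h; ring.
- have [w1 _ _ _] := tower2 jz.
  by apply: rE (conj (reach_refl _ _ _) w1); rewrite /h; ring.
- have [w1 _ _ _ _] := tower1 jz.
  by apply: rE (conj (reach_refl _ _ _) w1); rewrite /h; ring.
- have [w1 _] := tower0 jz.
  by apply: rE (conj (reach_refl _ _ _) w1); rewrite /h; ring.
- have [_ _ w1 _] := tower3 jz; have [_ r _] := reach_tower3 jz.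
  by apply: rE (conj r w1); ring.
- have [_ _ _ w2 _] := tower1 jz; have [_ _ r _] := reach_tower1 jz.
  by apply: rE (conj r w2); ring.
- have [_ _ w2 _] := tower2 jz; have [_ r _] := reach_tower2 jz.
  by apply: rE (conj r w2); rewrite /h; ring.
- have [_ _ w3 _ _] := tower1 jz; have [_ r _ _] := reach_tower1 jz.
  by apply: rE (conj r w3); rewrite /h; ring.
- have [_ w3 _ _] := tower3 jz; have [r _ _] := reach_tower3 jz.
  by apply: rE (conj r w3); rewrite /h; ring.
Qed.

Lemma floor_cover i y : (i < 4)%N -> cp i y ->
  exists j c s z, [/\ floor i j c s, cp j z & y = c + s * (m * z)].
Proof.
(* Since [s * s = 1], the floor map is inverted by [z = s * (y - c) / m]. The case splits below run
   through the floors of each piece from left to right. *)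
move=> i4 iy; have mk j c s : floor i j c s ->
    m * brk j <= s * (y - c) <= m * brk j.+1 ->
    exists j c s z, [/\ floor i j c s, cp j z & y = c + s * (m * z)].
  move=> fl; exists j, c, s, (s * (y - c) / m).
  split=> //; first by rewrite ler_pdivlMr ?ler_pdivrMr// ![_ * m]mulrC.
  rewrite [m * _]mulrC divfK ?gt_eqF// mulrA (floor_sign fl); ring.
case: i i4 iy mk => [|[|[|[|//]]]] _ /= iy mk.
- have [y1|y1] := lerP y (q + m - p - m * (p + m)); first by apply: mk Floor02 _ => /=; lin.
  have [y2|y2] := lerP y q; first by apply: mk Floor01 _ => /=; lin.
  by apply: mk Floor03 _ => /=; lin.
- have [y1|y1] := lerP y (q + m - m * (p + m)); first by apply: mk Floor12 _ => /=; lin.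
  have [y2|y2] := lerP y (q + m - m * p); first by apply: mk Floor11 _ => /=; lin.
  have [y3|y3] := lerP y (q + m); first by apply: mk Floor10 _ => /=; lin.
  by apply: mk Floor13 _ => /=; lin.
- have [y1|y1] := lerP y (2 * p + m * (p + m)); first by apply: mk Floor21 _ => /=; lin.
  by apply: mk Floor22 _ => /=; lin.
- have [y1|y1] := lerP y (q + m + 1 - 2 * p - m * p); first by apply: mk Floor31 _ => /=; lin.
  by apply: mk Floor33 _ => /=; lin.
Qed.

(** Whenever the orbit of [x] visits [z], that of [h x] visits [h z] and climbs the tower above it;
    the floor maps contract distances by [m]. *)
Lemma visits_h x d : visits x d -> visits (h x) (m * d).
Proof.
move=> vx i y i4 /(floor_cover i4)[j [c [s [w [fl jw ->]]]]].
have [z [rz jz zw]] := vx j w (floor_lt fl) jw.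
have [rphi iphi] := floor_reach fl jz.
exists (c + s * (m * z)); split=> //; first exact: reach_trans (reach_h rz) rphi.
have -> : c + s * (m * z) - (c + s * (m * w)) = s * m * (z - w) by ring.
have s1 : `|s| = 1 by apply/eqP; rewrite -sqrp_eq1// -normrX expr2 (floor_sign fl) normr1.
by rewrite !normrM s1 mul1r (gtr0_norm m0) ler_pM2l.
Qed.

(** Three renormalizations, [m = h (m + q)], [T (m + q) = h (m + 2 * q)] and [T (m + 2 * q) = h m],
    lead back to [m], whence the ratio. For [n = 0], the tower above the piece containing [m + q]
    has a floor in each of the four pieces. *)
Lemma visits_m n : visits m ((m * (m * m)) ^+ n).
Proof.
elim: n => [|n IH].
  have := tower1 b2_piece; have := reach_tower1 b2_piece.
  rewrite hb2 => -[r0 r3 r2 _] [i1 i0 i3 i2 _].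
  have close a b z y : 0 <= a -> b <= 1 -> a <= y <= b -> a < z < b -> `|z - y| <= (1 : R).
    by move=> a0 b1 ay az; rewrite ler_norml; lra.
  case=> [|[|[|[|//]]]] y _ /= iy; rewrite expr0.
  - by exists (m - p); split=> //; apply: close iy i0; lin.
  - by exists m; split=> //; [exact: reach_refl|apply: close iy i1; lin].
  - by exists (m * (m + q) + 2 * p); split=> //; apply: close iy i2; lin.
  - by exists (m + 1 - 2 * p); split=> //; apply: close iy i3; lin.
rewrite exprS -!mulrA -[in X in visits X]hb2.
apply/visits_h/(visits_T (domI _ b2_piece)) => //; rewrite Tb2.
apply/visits_h/(visits_T (domI _ b3_piece)) => //; rewrite Tb3.
exact: visits_h.
Qed.

Lemma orbit_m_close i y e : (i < 4)%N -> cp i y -> 0 < e ->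
  exists z, [/\ reach D T m z, op i z & `|z - y| < e].
Proof.
move=> i4 iy e0.
have m1 : 0 <= m * (m * m) < 1.
  have m1 : m < 1 by lin.
  by rewrite mulr_ge0 ?mulr_ile1 ?mulr_ilt1//; lin.
have /cvgrPdist_lt /(_ _ e0)[n _ /(_ n (leqnn n))] :
    (m * (m * m)) ^+ n @[n --> \oo] --> (0 : R).
  by apply: cvg_expr; rewrite ger0_norm; case/andP: m1.
rewrite /= sub0r normrN => en.
have [z [rz iz zy]] := visits_m n i4 iy.
exists z; split=> //; apply: le_lt_trans zy (le_lt_trans _ en).
exact: ler_norm.
Qed.

(** * Affine form of the branches *)

Definition slope (i : nat) : R := if (i < 2)%N then 1 else - 1.

Definition offset (i : nat) : R :=
  match i with
  | 0 => 1 - p | 1 => - p | 2 => p + 2 * m + q | _ => p + 2 * m + 3 * q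
  end.

Lemma TE i x : (i < 4)%N -> op i x -> T x = slope i * x + offset i.
Proof.
case: i => [|[|[|[|//]]]] _ /= ix; rewrite /slope /=.
- by rewrite T0; lin.
- by rewrite T1; lin.
- by rewrite T2; lin.
- by rewrite T3; lin.
Qed.

Lemma slope_sq i : slope i * slope i = 1.
Proof. by rewrite /slope; case: ifP => _; rewrite ?mulrNN mulr1. Qed.

Lemma brk_lt i : (i < 4)%N -> brk i < brk i.+1.
Proof. by case: i => [|[|[|[|//]]]] _ /=; lin. Qed.

Lemma brk_piece i : (i < 4)%N -> 0 <= brk i /\ brk i.+1 <= 1.
Proof. by case: i => [|[|[|[|//]]]] _ /=; lin. Qed.

(** Points close to [y] pass through the same open pieces during [k] steps, so [T^k] is affine
    there, with slope the product of the slopes met. *)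
Lemma iter_T_near k y : in_dom_iter D T k y ->
  exists2 d, 0 < d & exists2 s, s * s = 1 & forall z, `|z - y| < d ->
    in_dom_iter D T k z /\ iter k T z = iter k T y + s * (z - y).
Proof.
elim: k y => [|k IH] y.
  by move=> _; exists 1 => //; exists 1; rewrite ?mulr1// => z _; split=> //=; ring.
rewrite in_dom_iterS => -[/domP[i i4 iy] /IH[d d0 [s s1 sP]]].
exists (Num.min d (Num.min (y - brk i) (brk i.+1 - y))).
  by rewrite !lt_min d0/= !subr_gt0.
exists (s * slope i); first by rewrite mulrACA s1 slope_sq mulr1.
move=> z; rewrite !lt_min => /and3P[zd zl zr].
have iz : op i z by move: zl zr; rewrite !ltr_norml; lra.
have TzE : T z - T y = slope i * (z - y) by rewrite !(TE i4)//; ring.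
have /sP[nz ez] : `|T z - T y| < d.
  by rewrite TzE normrM /slope; case: ifP => _; rewrite ?normrN1 ?normr1 mul1r.
rewrite in_dom_iterS !iterSr ez TzE mulrA; split=> //; split=> //.
exact: domI iz.
Qed.

(** * Minimality *)

(** A finite set is closed, so it would contain the whole interval in which it is dense. *)
Lemma reach_m_infinite : ~ finite_set (reach D T m).
Proof.
move=> fin.
have cl : closed (reach D T m).
  by apply: compact_closed; [exact: Rhausdorff|exact: finite_compact].
have p0 : 0 < p by lin.
apply: (itv_infinite p0); apply: sub_finite_set fin => y /= iy.
apply: cl => B /nbhs_ballP[e /= e0 eB].
have [|z [rz _ zy]] := @orbit_m_close 0 y e isT _ e0; first by rewrite /=; lra.
by exists z; split=> //; apply: eB; rewrite /ball/= distrC.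
Qed.

(** A repetition would confine the forward orbit to its first [j] points. *)
Lemma iter_m_inj i j : (i < j)%N -> iter i T m <> iter j T m.
Proof.
move=> ij e; apply: reach_m_infinite.
apply: (@sub_finite_set _ _ ((fun k => iter k T m) @` `I_j)); last first.
  exact/finite_image/finite_II.
move=> _ [n [_ ->]]; elim/ltn_ind: n => n IH.
have [nj|jn] := ltnP n j; first by exists n.
have -> : iter n T m = iter (n - (j - i)) T m.
  have -> : n = (n - j + j)%N by rewrite subnK.
  rewrite iterD -e -iterD; congr (iter _ T m); lia.
apply: IH; lia.
Qed.

(* A periodic orbit would be surrounded by periodic points, among which there
   are points of the dense orbit of m. *)
Lemma no_periodic k y : (0 < k)%N -> in_dom_iter D T k y -> iter k T y <> y.
Proof.
move=> k0 ky e.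
have [d d0 [s s1 sP]] := iter_T_near ky.
have [|i i4 iy] := @domP y; first exact: (ky 0%N k0).
have [|z [[n [_ zE]] _ zy]] := @orbit_m_close i y d i4 _ d0; first lra.
have [_ e1] := sP z zy.
have s1' : `|s| = 1.
  apply/eqP; rewrite -sqrp_eq1// -normrX expr2 s1 normr1//.
have [|_ e2] := sP (iter k T z).
  by rewrite e1 e addrAC subrr add0r normrM s1' mul1r.
(* Near [y] the map [T^k] is the identity or the reflection about [y]; in both cases its square
   fixes [z]. *)
have : iter (k + k + n) T m = iter n T m.
  rewrite !iterD -zE e2 e1 e.
  have -> : s * (y + s * (z - y) - y) = s * s * (z - y) by ring.
  by rewrite s1; ring.
by apply/nesym/iter_m_inj; lia.
Qed.

(** From left to right, the images of pieces 1, 2, 3, 0 tile the unit interval, leaving out only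
    their end points. *)
Lemma preimage x : 0 < x < 1 -> x <> m -> x <> m + q -> x <> m + 2 * q ->
  exists2 y, D y & T y = x.
Proof.
move=> x01 /eqP x1 /eqP x2 /eqP x3.
have [xm|mx] := ltrP x m.
  by exists (x + p); [apply: (@domI 1)=> //=|rewrite T1]; lin.
have {}mx : m < x by rewrite lt_neqAle eq_sym x1.
have [xm|{}x1] := ltrP x (m + q).
  by exists (p + 2 * m + q - x); [apply: (@domI 2)=> //=|rewrite T2]; lin.
have {x2}x1 : m + q < x by rewrite lt_neqAle eq_sym x2.
have [xm|x2] := ltrP x (m + 2 * q).
  by exists (p + 2 * m + 3 * q - x); [apply: (@domI 3)=> //=|rewrite T3]; lin.
have {x3}x2 : m + 2 * q < x by rewrite lt_neqAle eq_sym x3.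
by exists (x - (1 - p)); [apply: (@domI 0)=> //=|rewrite T0]; lin.
Qed.

(** If all forward iterates exist, finiteness yields a periodic point. Otherwise no backward iterate
    is [m], [m + q] or [m + 2 * q], as these survive forever; hence all backward iterates exist, and
    finiteness again yields a periodic point. *)
Lemma orbit_infinite x : 0 < x < 1 -> ~ finite_set (Defs.orbit D T x).
Proof.
move=> x01 fin.
have [surv|] := pselect (forall n, in_dom_iter D T n x).
  have [|i [j [ij e]]] := pigeonhole_set (f := fun n => iter n T x) fin.
    by move=> n; apply: reach_orbit; exists n.
  apply: (@no_periodic (j - i) (iter i T x)).
  - by rewrite subn_gt0.
  - have := surv (i + (j - i))%N; rewrite in_dom_iterD => -[_]; exact.
  - by rewrite -iterD subnK ?(ltnW ij)// e.
move=> /existsNP[n0 dies].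
have back n : exists y, in_dom_iter D T n y /\ iter n T y = x.
  elim: n => [|n [y [ny yx]]]; first by exists x.
  have y01 : 0 < y < 1.
    case: n ny yx => [|n] ny yx; first by rewrite -yx in x01.
    exact: (dom_itv (ny 0%N isT)).
  have dead b : (forall k, in_dom_iter D T k b) -> y <> b.
    move=> bs yb; apply: dies; have := bs (n + n0)%N.
    by rewrite -yb in_dom_iterD yx => -[].
  have [z Dz zy] := preimage y01 (dead _ (fun k => let: And3 a _ _ := survive_images k in a))
    (dead _ (fun k => let: And3 _ a _ := survive_images k in a))
    (dead _ (fun k => let: And3 _ _ a := survive_images k in a)).
  by exists z; rewrite in_dom_iterS iterSr zy.
have [f fP] := choice back.
have [|i [j [ij e]]] := pigeonhole_set fin (f := f).
  by move=> n; right; exists n; exact: fP.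
have [ni ei] := fP i; have [nj ej] := fP j.
move: nj; rewrite -{1}(subnKC (ltnW ij)) in_dom_iterD -e ei => -[_ per].
apply: (no_periodic _ per); first by rewrite subn_gt0.
by rewrite -[in LHS]ei -iterD subnK ?(ltnW ij)// e ej.
Qed.

Lemma cp_cover x : 0 <= x <= 1 -> exists2 i, (i < 4)%N & cp i x.
Proof.
move=> x01; have [x1|x1] := lerP x p; first by exists 0%N => //=; lra.
have [x2|x2] := lerP x (p + m); first by exists 1%N => //=; lra.
have [x3|x3] := lerP x (p + m + q); first by exists 2%N => //=; lra.
by exists 3%N => //=; lra.
Qed.

Lemma T_minimal : iet_minimal 4 1 brk T.
Proof.
split; last by move=> x; rewrite in_itv /=; exact: orbit_infinite.
exists m; split; first by rewrite in_itv /=; lin.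
move=> x; rewrite /= in_itv /= => /cp_cover[i i4 ix] B /nbhs_ballP[e /= e0 eB].
have [z [rz _ zx]] := orbit_m_close i4 ix e0.
exists z; split; first exact: reach_orbit.
by apply: eB; rewrite /ball /= distrC.
Qed.

(** * Flips and maximality of the domain *)

Lemma T_flip i : (i < 4)%N -> iet_flip brk T i <-> (1 < i)%N.
Proof.
move=> i4; split=> [fl|i1 x y]; last first.
  rewrite !iet_pieceE => ix iy xy; rewrite !(TE i4)// /slope ltnNge i1 /=; lra.
rewrite ltnNge; apply/negP => i1.
have bi := brk_lt i4; set x := (2 * brk i + brk i.+1) / 3; set y := (brk i + 2 * brk i.+1) / 3.
have ix : op i x by rewrite /x; lra.
have iy : op i y by rewrite /y; lra.
have := fl x y; rewrite !iet_pieceE => /(_ ix iy).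
by rewrite !(TE i4)// /slope ltnS i1 /x /y; lra.
Qed.

Lemma T_nflips : iet_nflips 4 brk T = 2%N.
Proof.
have -> : iet_nflips 4 brk T = #|[pred i : 'I_4 | (1 < i)%N]|.
  apply: eq_card => i; rewrite !inE.
  apply/idP/idP => [/set_mem/asboolP/(T_flip (ltn_ord i))//|i1].
  exact/mem_set/asboolP/(T_flip (ltn_ord i)).
by rewrite -sum1_card big_mkcond !big_ord_recl big_ord0.
Qed.

Lemma T_dist i x y : (i < 4)%N -> op i x -> op i y -> `|T x - T y| = `|x - y|.
Proof.
move=> i4 ix iy; rewrite !(TE i4)//.
have -> : slope i * x + offset i - (slope i * y + offset i) = slope i * (x - y) by ring.
by rewrite normrM /slope; case: ifP => _; rewrite ?normrN1 ?normr1 mul1r.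
Qed.

(** The one-sided limits of [T] at the inner breakpoints differ by [1], [q] and [2 * q], in this
    order. *)
Lemma jump i : (i < 3)%N ->
  q <= `|(slope i * brk i.+1 + offset i) - (slope i.+1 * brk i.+1 + offset i.+1)|.
Proof.
case: i => [|[|[|//]]] _; rewrite /slope /=.
- by rewrite ger0_norm; lin.
- by rewrite ltr0_norm; lin.
- by rewrite ltr0_norm; lin.
Qed.

Lemma pieces_near i d : (i < 3)%N -> 0 < d ->
  exists2 t, 0 < t < d & op i (brk i.+1 - t) /\ op i.+1 (brk i.+1 + t).
Proof.
move=> i3 d0; have b1 := brk_lt (ltnW i3 : (i < 4)%N); have b2 := @brk_lt i.+1 i3.
exists (Num.min d (Num.min (brk i.+1 - brk i) (brk i.+2 - brk i.+1)) / 2).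
  by rewrite divr_gt0 ?lt_min ?d0 ?subr_gt0 ?b1 ?b2//= ltr_pdivrMr// gt_min; apply/orP; left; lra.
set t := Num.min _ _.
have : t <= brk i.+1 - brk i by rewrite /t ge_min ge_min lexx orbT.
have : t <= brk i.+2 - brk i.+1 by rewrite /t ge_min ge_min lexx !orbT.
have : 0 < t by rewrite /t !lt_min d0 !subr_gt0 b1.
by move: t => t *; lra.
Qed.

(** A larger open subset of [[0, 1]] contains an inner breakpoint, where a continuous extension
    would have to be close to both one-sided limits. *)
Lemma T_not_extendable : ~ exists (U : set R) (g : R -> R),
  [/\ open U, U `<=` `[0, 1], D `<` U, {within U, continuous g} & {in D, g =1 T}].
Proof.
move=> [U [g [oU U01 [DU nUD] cg gT]]].
have [b Ub nDb] : exists2 b, U b & ~ D b.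
  by have /nonsubset[b []] := nUD; exists b.
have /nbhs_ballP[e /= e0 eU] : nbhs b U by exact: open_nbhs_nbhs.
have b01 : 0 < b < 1.
  have /U01 : U (b - e / 2) by apply: eU; rewrite /ball /= ltr_norml; lra.
  have /U01 : U (b + e / 2) by apply: eU; rewrite /ball /= ltr_norml; lra.
  by rewrite /= !in_itv /=; lra.
have [i i3 bi] : exists2 i, (i < 3)%N & b = brk i.+1.
  have [i i4 ib] : exists2 i, (i < 4)%N & cp i b by apply: cp_cover; lra.
  have [bi|nbi] := eqVneq b (brk i.+1).
    exists i => //; rewrite ltnNge; apply/negP => i3.
    by move: i4 bi b01 i3; case: i {ib} => [|[|[|[|]]]]//= _ ->; rewrite ltxx andbF.
  have [bi|nbi'] := eqVneq b (brk i).
    case: i i4 {ib nbi} bi => [_ bi|i i4 bi]; last by exists i.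
    by rewrite bi /= ltxx in b01.
  by case: nDb; apply: (domI i4); rewrite !lt_neqAle eq_sym nbi' nbi.
have q0 : 0 < q by lin.
(* Four errors below [q / 4], two from continuity and two from the shift by [t], stay below the
   jump. *)
have q4 : 0 < q / 4 by lra.
have /cvgrPdist_lt /(_ _ q4) /nbhs_ballP[d /= d0 dP] : {for b, continuous g}.
  by move: cg; rewrite continuous_open_subspace//; apply; rewrite inE.
have min0 : 0 < Num.min d (q / 4) by rewrite lt_min d0.
have [t] := pieces_near i3 min0.
rewrite lt_min => /and3P[t0 td tq] [zi wi].
have Dz : D (b - t) by rewrite bi; exact: (@domI i _ (ltnW i3) zi).
have Dw : D (b + t) by rewrite bi; exact: (@domI i.+1 _ i3 wi).
have [Tz Tw] := (@TE i _ (ltnW i3) zi, @TE i.+1 _ i3 wi); rewrite -bi in Tz Tw.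
have /dP : ball b d (b - t) by rewrite /ball /= opprB addrC subrK gtr0_norm.
have /dP : ball b d (b + t) by rewrite /ball /= opprD addrA subrr sub0r normrN gtr0_norm.
rewrite /= (gT (b - t)) ?(gT (b + t)) ?inE// Tz Tw.
have := jump i3; rewrite -bi.
have : `|slope i * t| < q / 4.
  by rewrite normrM /slope; case: ifP => _; rewrite ?normrN1 ?normr1 mul1r gtr0_norm.
have : `|slope i.+1 * t| < q / 4.
  by rewrite normrM /slope; case: ifP => _; rewrite ?normrN1 ?normr1 mul1r gtr0_norm.
rewrite mulrBr mulrDr; move: (slope i.+1 * t) (slope i * t) (slope i * b) (slope i.+1 * b).
move: (g b) (offset i) (offset i.+1) => gb o1 o2 r1 r2 r3 r4.
by rewrite !ltr_norml ler_normr => ? ? /orP[] ?; lra.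
Qed.

Lemma T_IET : is_IET 4 1 brk T.
Proof.
split.
- by split=> //; split=> // i; exact: brk_lt.
- by move=> x /T_itv; rewrite in_itv /=; lra.
- by move=> i i4 x y; rewrite !iet_pieceE; exact: T_dist.
- exact: T_inj.
- exact: T_not_extendable.
Qed.

(** * The circle exchange *)

Definition arc (i : nat) : R :=
  match i with 0 => 0 | 1 => p + m | 2 => p + m + q | _ => 1 end.

Definition arc_slope (i : nat) : R := if i is 0 then 1 else - 1.

(** Modulo 1 the branches [x + (1 - p)] and [x - p] coincide, so the merged arc has the single
    offset [- p]. *)
Definition arc_offset (i : nat) : R :=
  match i with 0 => - p | 1 => p + 2 * m + q | _ => p + 2 * m + 3 * q end.

(** The arcs lie in [[0, 1]], so none wraps around and the integer shift must be zero. *)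
Lemma cet_pieceP i x : (i < 3)%N -> cet_piece arc i x <-> arc i < x < arc i.+1.
Proof.
move=> i3; have [a0 a1] : 0 <= arc i /\ arc i.+1 <= 1.
  by case: i i3 => [|[|[|//]]] _ /=; lin.
split=> [[xc [k kx]]|ix]; last first.
  by split; [rewrite /circle /= in_itv /=; lra|exists 0; rewrite addr0].
move: xc; rewrite /circle /= in_itv /= => x01.
have : (- 1)%:~R < k%:~R :> R by rewrite rmorphN1; lra.
have : k%:~R < 1%:~R :> R by rewrite rmorph1; lra.
rewrite !ltr_int => k1 k0; have k0' : k = 0 by lia.
by move: kx; rewrite k0' addr0.
Qed.

Lemma arc_itv i x : (i < 3)%N -> arc i < x < arc i.+1 -> 0 < x < 1.
Proof. by case: i => [|[|[|//]]] _ /=; lin. Qed.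

Lemma cet_domI i x : (i < 3)%N -> arc i < x < arc i.+1 -> cet_dom 3 arc x.
Proof. by move=> i3 ix; exists i => //; exact/cet_pieceP. Qed.

Lemma cet_domP x : cet_dom 3 arc x -> exists2 i, (i < 3)%N & arc i < x < arc i.+1.
Proof. by move=> [i i3 /(cet_pieceP _ i3)]; exists i. Qed.

Lemma sub_cet_dom x : D x -> cet_dom 3 arc x.
Proof.
case/dom4 => ix; [apply: (@cet_domI 0)|apply: (@cet_domI 0)|
  apply: (@cet_domI 1)|apply: (@cet_domI 2)] => //=; lin.
Qed.

Lemma T_arc i x : (i < 3)%N -> arc i < x < arc i.+1 ->
  T x = Defs.frac (arc_slope i * x + arc_offset i).
Proof.
case: i => [|[|[|//]]] _ /= ix.
- have [xp|px] := ltrP x p.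
    by rewrite T0 ?mul1r -1?(fracDz _ 1) ?frac_small ?rmorph1; lin.
  by rewrite T1 ?frac_small; lin.
- by rewrite T2 ?frac_small; lin.
- by rewrite T3 ?frac_small; lin.
Qed.

Lemma T_circle x : cet_dom 3 arc x -> circle (T x).
Proof.
move=> /cet_domP[i i3 ix]; rewrite (T_arc i3)// /circle /= in_itv /=.
set u := _ + _; have := floor_le u; have := floorD1_gt u.
by rewrite /Defs.frac rmorphD /= => ? ?; lra.
Qed.

(** The only new point is [p]; its image 0 is not in [T D], which lies in the open unit interval. *)
Lemma T_cet_inj : {in cet_dom 3 arc &, injective T}.
Proof.
have dom_or y : cet_dom 3 arc y -> D y \/ y = p.
  case/cet_domP => -[|[|[|//]]] _ /= iy.
  - have [yp|py|->] := ltrgtP y p; last by right.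
      by left; apply: (@domI 0) => //=; lin.
    by left; apply: (@domI 1) => //=; lin.
  - by left; apply: (@domI 2).
  - by left; apply: (@domI 3).
have Tp : T p = 0 by rewrite T1; lin.
move=> x y; rewrite !inE => /dom_or[Dx|->] /dom_or[Dy|->] //.
- by apply: T_inj; rewrite inE.
- by have := T_itv Dx; rewrite Tp; lra.
- by have := T_itv Dy; rewrite Tp; lra.
Qed.

Lemma T_cdist i x y : (i < 3)%N -> arc i < x < arc i.+1 -> arc i < y < arc i.+1 ->
  cdist (T x) (T y) = cdist x y.
Proof.
move=> i3 ix iy; rewrite !(T_arc i3)// cdist_frac.
case: i {i3 ix iy} => [|i].
  by rewrite /cdist; congr (Num.min (Defs.frac _) (Defs.frac _)); rewrite /=; ring.
by rewrite cdistC /cdist; congr (Num.min (Defs.frac _) (Defs.frac _)); rewrite /=; ring.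
Qed.


Definition arc_pred (i : nat) : nat := if i is j.+1 then j else 2.

(** The integer [k] runs over the lifts. Modulo 1 the one-sided limits at the three breakpoints
    differ by [q], [q] and [2 * q], and [2 * q <= 1 - q]. *)
Lemma arc_jump i (k : int) : (i < 3)%N ->
  q <= `|(arc_slope (arc_pred i) * arc (arc_pred i).+1 + arc_offset (arc_pred i))
         - (arc_slope i * arc i + arc_offset i) + k%:~R|.
Proof.
move=> i3; have far u (l : int) : q <= u <= 1 - q -> q <= `|l%:~R - u|.
  move=> uq; have [k0|k1] := lerP l 0.
    have : l%:~R <= 0 :> R by rewrite (ler_int R l 0).
    by rewrite distrC ler_normr => ?; apply/orP; left; lra.
  have : 1 <= l%:~R :> R by rewrite (ler_int R 1 l).
  by rewrite ler_normr => ?; apply/orP; left; lra.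
case: i i3 => [|[|[|//]]] _ /=.
- rewrite [X in `|X|](_ : _ = (k + 1)%:~R - q); last by rewrite rmorphD /=; lin.
  by apply: far; lin.
- rewrite [X in `|X|](_ : _ = k%:~R - q); last by lin.
  by apply: far; lin.
- rewrite [X in `|X|](_ : _ = k%:~R - 2 * q); last by lin.
  by apply: far; lin.
Qed.

Lemma arcs_near i d : (i < 3)%N -> 0 < d -> exists2 t, 0 < t < d &
  arc (arc_pred i) < arc (arc_pred i).+1 - t < arc (arc_pred i).+1 /\
  arc i < arc i + t < arc i.+1.
Proof.
move=> i3 d0.
have b2 : arc i < arc i.+1 by case: i i3 => [|[|[|//]]] _ /=; lin.
have b1 : arc (arc_pred i) < arc (arc_pred i).+1.
  by case: i i3 {b2} => [|[|[|//]]] _ /=; lin.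
move: (arc (arc_pred i)) (arc (arc_pred i).+1) (arc i) (arc i.+1) b1 b2 => a b c e ab ce.
exists (Num.min d (Num.min (b - a) (e - c)) / 2).
  by rewrite divr_gt0 ?lt_min ?d0 ?subr_gt0 ?ab ?ce//= ltr_pdivrMr// gt_min; apply/orP; left; lra.
set t := Num.min _ _.
have : t <= b - a by rewrite /t ge_min ge_min lexx orbT.
have : t <= e - c by rewrite /t ge_min ge_min lexx !orbT.
have : 0 < t by rewrite /t !lt_min d0 !subr_gt0 ab.
by move: t => t *; lra.
Qed.

Lemma T_cet_not_extendable : ~ exists (U : set R) (g : R -> R),
  [/\ circ_open U, cet_dom 3 arc `<` U, (forall x, U x -> circle (g x)),
      circ_continuous_on U g & {in cet_dom 3 arc, g =1 T}].
Proof.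
move=> [U [g [[Uc oU] [DU nUD] _ cg gT]]].
have [b Ub nDb] : exists2 b, U b & ~ cet_dom 3 arc b.
  by have /nonsubset[b []] := nUD; exists b.
have b01 : 0 <= b < 1 by have := Uc b Ub; rewrite /circle /= in_itv.
have [i i3 bi] : exists2 i, (i < 3)%N & b = arc i.
  have [b0|b0] := eqVneq b 0; first by exists 0%N.
  have [b1|b1] := eqVneq b (p + m); first by exists 1%N.
  have [b2|b2] := eqVneq b (p + m + q); first by exists 2%N.
  case: nDb.
  have [{}b1|b1'|/eqP] := ltgtP b (p + m); last by rewrite (negPf b1).
    by apply: (@cet_domI 0) => //=; move: b0 b01; rewrite neq_lt; lra.
  have [{}b2|b2'|/eqP] := ltgtP b (p + m + q); last by rewrite (negPf b2).
    by apply: (@cet_domI 1) => //=; lra.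
  by apply: (@cet_domI 2) => //=; lra.
have q0 : 0 < q by lin.
have q4 : 0 < q / 4 by lra.
have [d d0 dP] := cg b Ub _ q4.
have min0 : 0 < Num.min d (q / 4) by rewrite lt_min d0.
have [t] := arcs_near i3 min0; rewrite lt_min => /and3P[t0 td tq] [zi wi].
have j3 : (arc_pred i < 3)%N by case: (i) i3 => // k /ltnW.
set z := arc (arc_pred i).+1 - t in zi.
(* On the circle [z] precedes [b] by [t], also for [b = 0], where [z] is [1 - t]. *)
have zb : cdist b z = cdist t 0.
  have zE : exists k : int, z - b = k%:~R - t.
    rewrite /z bi; case: (i) i3 => [|k] _ /=; first by exists 1; rewrite rmorph1; ring.
    by exists 0; ring.
  have [k zk] := zE; rewrite /cdist zk subr0 sub0r.
  have -> : b - z = t + (- k)%:~R by rewrite -opprB zk rmorphN; ring.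
  by rewrite [k%:~R - t]addrC !fracDz.
have t1 : `|t - 0| < 1 by rewrite subr0 gtr0_norm//; lin.
have zd : cdist b z < d.
  by rewrite zb; apply: le_lt_trans (cdist_le t1) _; rewrite subr0 gtr0_norm.
have wd : cdist b (arc i + t) < d.
  have e : `|b - (arc i + t)| = t by rewrite bi opprD addrA subrr sub0r normrN gtr0_norm.
  by apply: le_lt_trans (cdist_le _) _; rewrite e//; move: t1; rewrite subr0 gtr0_norm.
have Dz := cet_domI j3 zi; have Dw := cet_domI i3 wi.
have [k1] := cdist_lt (dP z (DU _ Dz) zd).
have [k2] := cdist_lt (dP _ (DU _ Dw) wd).
rewrite (gT z) ?(gT (arc i + t)) ?inE//.
rewrite (T_arc j3 zi) (T_arc i3 wi) /z /Defs.frac; set f1 := Num.floor _; set f2 := Num.floor _.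
(* The integer parts of both values and the integers from both circle distances merge into the one
   lift of [arc_jump]. *)
have kE : (f1 + k2 - (f2 + k1))%:~R = f1%:~R + k2%:~R - (f2%:~R + k1%:~R) :> R.
  by rewrite rmorphB !rmorphD.
have := arc_jump (f1 + k2 - (f2 + k1)) i3; rewrite kE.
have st k : `|arc_slope k * t| < q / 4.
  by case: k => [|k]; rewrite ?mul1r ?mulN1r ?normrN gtr0_norm.
have := st i; have := st (arc_pred i).
by rewrite !ltr_norml ler_normr => ? ? /orP[] ? ? ?; lra.
Qed.

Lemma T_CET : is_CET 3 arc T.
Proof.
split.
- by split=> [||| [|[|[|//]]] _] /=; lin.
- exact: T_circle.
- by move=> i i3 x y /(cet_pieceP _ i3) ix /(cet_pieceP _ i3); exact: T_cdist ix.
- exact: T_cet_inj.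
- exact: T_cet_not_extendable.
Qed.

Lemma T_cet_flip i : (i < 3)%N -> cet_flip arc T i <-> (0 < i)%N.
Proof.
move=> i3; split=> [fl|i0 t s ti ts si].
  (* On the first arc the image moves forward, so the fractional part is [1 - p / 4] where a flip
     would give [p / 4]. *)
  case: i i3 fl => // _ /(_ (p / 4) (p / 2)) /=.
  rewrite (frac_small (x := p / 4)) ?(frac_small (x := p / 2)); [|lin..].
  rewrite (@T_arc 0 (p / 4)) ?(@T_arc 0 (p / 2)) ?frac_sub//=; [|lin..].
  move=> fl; have : Defs.frac (1 * (p / 4) - p - (1 * (p / 2) - p)) = 1 - p / 4.
    rewrite -(fracDz _ 1) frac_small ?rmorph1; lin.
  by rewrite fl; lin.
have ti' : arc i < t < arc i.+1 by rewrite ti (lt_trans ts).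
have si' : arc i < s < arc i.+1 by rewrite si (lt_trans ti).
have t01 := arc_itv i3 ti'; have s01 := arc_itv i3 si'.
rewrite (frac_small (x := t)) ?(frac_small (x := s)); [|lra..].
rewrite !(T_arc i3)// frac_sub; case: i i0 {i3 ti si ti' si'} => // i _ /=.
by rewrite frac_small; lra.
Qed.

Lemma T_cet_nflips : cet_nflips 3 arc T = 2%N.
Proof.
have -> : cet_nflips 3 arc T = #|[pred i : 'I_3 | (0 < i)%N]|.
  apply: eq_card => i; rewrite !inE.
  apply/idP/idP => [/set_mem/asboolP/(T_cet_flip (ltn_ord i))//|i1].
  exact/mem_set/asboolP/(T_cet_flip (ltn_ord i)).
by rewrite -sum1_card big_mkcond !big_ord_recl big_ord0.
Qed.

Lemma T_cet_transitive : cet_transitive 3 arc T.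
Proof.
exists m; split; first by rewrite /circle /= in_itv /=; lin.
move=> x; rewrite /circle /= in_itv /= => x01 e e0.
have [i i4 ix] : exists2 i, (i < 4)%N & cp i x by apply: cp_cover; lra.
(* The bound 1 is what [cdist_le] asks for. *)
have e1 : 0 < Num.min e 1 by rewrite lt_min e0 ltr01.
have [z [[n [nm ->]] _]] := orbit_m_close i4 ix e1.
rewrite lt_min distrC => /andP[ze z1].
exists (iter n T m); last exact: le_lt_trans (cdist_le z1) ze.
by left; exists n; split=> // k kn; exact/sub_cet_dom/nm.
Qed.

(** * Invariant distribution functions *)

(* The symmetrized distribution functions of invariant measures have this
   property; it is stated on closed pieces, which spares atoms at their ends. *)
Definition invariant_cdf (G : R -> R) : Prop :=
  (forall x y, 0 <= x -> x <= y -> y <= 1 -> G x <= G y) /\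
  (forall i x y, (i < 4)%N -> cp i x -> cp i y ->
    G (slope i * y + offset i) - G (slope i * x + offset i)
    = slope i * (G y - G x)).

(** The sign makes the result nondecreasing again, as [h] reverses orientation. *)
Definition renorm (G : R -> R) (x : R) : R := - G (h x).

Section InvariantCdf.
Variable G : R -> R.
Hypothesis invG : invariant_cdf G.

Let mono x y : 0 <= x -> x <= y -> y <= 1 -> G x <= G y.
Proof. by case: invG => + _; apply. Qed.

Let mul_citv a b x : a <= x <= b -> m * a <= m * x <= m * b.
Proof. by rewrite !ler_pM2l. Qed.

Let step i x y x' y' : (i < 4)%N -> cp i x -> cp i y ->
  x' = slope i * x + offset i -> y' = slope i * y + offset i ->
  G y' - G x' = slope i * (G y - G x).
Proof. by case: invG => _ + i4 ix iy -> ->; apply. Qed.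

(** Each step up the tower above [h I_j] preserves increments of [G] up to the slope of the branch.
    The first part records this on every floor, the second after the last step, on arrival in
    [h (T I_j)]. *)
Lemma floor_top j x y : (j < 4)%N -> cp j x -> cp j y ->
  (forall i c s, floor i j c s ->
    G (c + s * (m * y)) - G (c + s * (m * x)) = s * (renorm G y - renorm G x))
  /\ G (h (slope j * y + offset j)) - G (h (slope j * x + offset j))
     = slope j * (G (h y) - G (h x)).
Proof.
have hd u v : renorm G v - renorm G u = - (G (h v) - G (h u)) by rewrite /renorm; ring.
have val a b a' b' r : a = a' -> b = b' -> G a' - G b' = r -> G a - G b = r.
  by move=> -> ->.
case: j => [|[|[|[|//]]]] _ /= ix iy; have := mul_citv ix; have := mul_citv iy => my mx.
- split; last first.
    by rewrite /slope /= (step (i := 1) (x := h x) (y := h y)) //;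
      rewrite /slope /offset /= /h; lin.
  move=> i c s fl; inversion fl; subst; rewrite hd.
  by apply: (val _ _ (h y) (h x)); rewrite /h; ring.
- have e1 : G (h y - p) - G (h x - p) = G (h y) - G (h x).
    by rewrite (step (i := 1) (x := h x) (y := h y)) /slope /offset /= ?mul1r //;
      rewrite /h; lin.
  have e2 : G (h y + 1 - 2 * p) - G (h x + 1 - 2 * p) = G (h y) - G (h x).
    by rewrite (step (i := 0) (x := h x - p) (y := h y - p)) /slope /offset /= ?mul1r //;
      rewrite /h; lin.
  have e3 : G (m * y + 2 * p) - G (m * x + 2 * p) = - (G (h y) - G (h x)).
    by rewrite (step (i := 3) (x := h x + 1 - 2 * p) (y := h y + 1 - 2 * p))
      /slope /offset /= ?mulN1r ?e2 //; rewrite /h; lin.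
  have e4 : G (h (1 * y - p)) - G (h (1 * x - p)) = G (h y) - G (h x).
    by rewrite (step (i := 2) (x := m * x + 2 * p) (y := m * y + 2 * p))
      /slope /offset /= ?mulN1r ?e3 ?opprK //; rewrite /h; lin.
  split; last by rewrite /slope /= e4 mul1r.
  move=> i c s fl; inversion fl; subst; rewrite hd ?mulrN ?mulNr ?mul1r ?opprK.
  + by apply: val e1; rewrite /h; ring.
  + by apply: (val _ _ (h y) (h x)); rewrite /h; ring.
  + by apply: val e3; ring.
  + by apply: val e2; rewrite /h; ring.
- have e1 : G (h y - p) - G (h x - p) = G (h y) - G (h x).
    by rewrite (step (i := 1) (x := h x) (y := h y)) /slope /offset /= ?mul1r //;
      rewrite /h; lin.
  have e2 : G (h y + 1 - 2 * p) - G (h x + 1 - 2 * p) = G (h y) - G (h x).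
    by rewrite (step (i := 0) (x := h x - p) (y := h y - p)) /slope /offset /= ?mul1r //;
      rewrite /h; lin.
  split; last first.
    by rewrite (step (i := 2) (x := h x + 1 - 2 * p) (y := h y + 1 - 2 * p))
      /slope /offset /= ?e2 //; rewrite /h; lin.
  move=> i c s fl; inversion fl; subst; rewrite hd ?mulrN ?mulNr ?mul1r ?opprK.
  + by apply: val e1; rewrite /h; ring.
  + by apply: (val _ _ (h y) (h x)); rewrite /h; ring.
  + by apply: val e2; rewrite /h; ring.
- have e1 : G (h y + 1 - p) - G (h x + 1 - p) = G (h y) - G (h x).
    by rewrite (step (i := 0) (x := h x) (y := h y)) /slope /offset /= ?mul1r //;
      rewrite /h; lin.
  have e2 : G (m * y + p) - G (m * x + p) = - (G (h y) - G (h x)).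
    by rewrite (step (i := 3) (x := h x + 1 - p) (y := h y + 1 - p))
      /slope /offset /= ?mulN1r ?e1 //; rewrite /h; lin.
  split; last first.
    by rewrite (step (i := 1) (x := m * x + p) (y := m * y + p))
      /slope /offset /= ?e2 ?mulN1r ?mul1r //; rewrite /h; lin.
  move=> i c s fl; inversion fl; subst; rewrite hd ?mulrN ?mulNr ?mul1r ?opprK.
  + by apply: (val _ _ (h y) (h x)); rewrite /h; ring.
  + by apply: val e2; ring.
  + by apply: val e1; rewrite /h; ring.
Qed.

Lemma invariant_renorm : invariant_cdf (renorm G).
Proof.
split=> [x y x0 xy y1|i x y i4 ix iy].
  have : m * 0 <= m * x by rewrite ler_pM2l.
  have : m * x <= m * y by rewrite ler_pM2l.
  have : m * y <= m * 1 by rewrite ler_pM2l.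
  by move=> *; rewrite lerN2; apply: mono; rewrite /h; lin.
have [_ e] := floor_top i4 ix iy.
by move: e; rewrite /renorm; lra.
Qed.

Lemma floor_incr i j c s : floor i j c s ->
  G (c + s * (m * brk j.+1)) - G (c + s * (m * brk j))
  = s * (renorm G (brk j.+1) - renorm G (brk j)).
Proof.
move=> fl; have j4 := floor_lt fl; have lt_j : brk j < brk j.+1 := brk_lt j4.
have c0 : cp j (brk j) by rewrite lexx ltW.
have c1 : cp j (brk j.+1) by rewrite lexx ltW.
by have [/(_ _ _ _ fl)] := floor_top j4 c0 c1.
Qed.

End InvariantCdf.

(** * Increments on the pieces: the Perron-Frobenius contraction *)

Definition incr (G : R -> R) (i : nat) : R := G (brk i.+1) - G (brk i).

Definition len (i : nat) : R := match i with 0 => p | 1 => m | _ => q end.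

(** The increment over a piece telescopes over the floors in it; the coefficients form the incidence
    matrix of the towers. *)
Lemma incr_renorm G (r := incr (renorm G)) : invariant_cdf G ->
  [/\ incr G 0 = r 1%N + r 2%N + r 3%N, incr G 1 = r 0%N + r 1%N + r 2%N + r 3%N,
      incr G 2 = r 1%N + r 2%N & incr G 3 = r 1%N + r 3%N].
Proof.
move=> invG; rewrite /r /incr.
have fl i j c s a b : floor i j c s -> a = c + s * (m * brk j) ->
    b = c + s * (m * brk j.+1) ->
    G b - G a = s * (renorm G (brk j.+1) - renorm G (brk j)).
  by move=> f -> ->; exact: (floor_incr invG f).
(* Together with [q] and [q + m], these are the points inside the pieces where consecutive floors
   meet. *)
set e1 := q + m - p - m * (p + m); set e2 := q + m - m * (p + m).
set e3 := q + m - m * p; set e5 := 2 * p + m * (p + m).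
set e6 := q + m + 1 - 2 * p - m * p.
have := fl _ _ _ _ e1 0 Floor02; have := fl _ _ _ _ q e1 Floor01.
have := fl _ _ _ _ p q Floor03; have := fl _ _ _ _ e2 p Floor12.
have := fl _ _ _ _ e3 e2 Floor11; have := fl _ _ _ _ (q + m) e3 Floor10.
have := fl _ _ _ _ (q + m) (p + m) Floor13; have := fl _ _ _ _ (p + m) e5 Floor21.
have := fl _ _ _ _ (p + m + q) e5 Floor22.
have := fl _ _ _ _ e6 (p + m + q) Floor31; have := fl _ _ _ _ 1 e6 Floor33.
rewrite /= /e1 /e2 /e3 /e5 /e6.
do 11 (move=> /(_ ltac:(lin) ltac:(lin)) ?).
split; lra.
Qed.

(* (m, 1, 1 - p, 1 - p) is the left eigenvector of the incidence matrix. *)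
Definition mass (G : R -> R) : R :=
  m * incr G 0 + incr G 1 + (1 - p) * (incr G 2 + incr G 3).

(** The value of [mass] for Lebesgue measure, whose increments are [len]. *)
Definition mass1 : R := m * p + m + (1 - p) * (q + q).

(** A division-free measure of how far the increments are from proportional to [len]; the left
    eigenvector annihilates it. *)
Definition defect (G : R -> R) (i : nat) : R := mass1 * incr G i - mass G * len i.

Lemma mass_renorm G : invariant_cdf G -> mass (renorm G) = m * mass G.
Proof.
move=> /incr_renorm; rewrite /mass => -[-> -> -> ->].
move: (incr _ 0) (incr _ 1) (incr _ 2) (incr _ 3) => a b c d.
have hb : m * m + m + 2 * (m * (1 - p)) = 1 by lin.
have hc : m * m + m + m * (1 - p) = 1 - p by lin.
transitivity (m * a + (m * m + m + 2 * (m * (1 - p))) * b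
  + (m * m + m + m * (1 - p)) * (c + d)); first by rewrite hb hc; ring.
ring.
Qed.

(** The matrix multiplies [len] by the inverse of [m], while [renorm] multiplies the mass by [m]; so
    [mass G * len] obeys the same recursion as the increments. *)
Lemma defect_renorm G (d := defect (renorm G)) : invariant_cdf G ->
  [/\ defect G 0 = d 1%N + d 2%N + d 3%N, defect G 1 = d 0%N + d 1%N + d 2%N + d 3%N,
      defect G 2 = d 1%N + d 2%N & defect G 3 = d 1%N + d 3%N].
Proof.
move=> invG; rewrite /d /defect (mass_renorm invG).
have [-> -> -> ->] := incr_renorm invG.
have ev u v : u = m * v -> mass G * u = m * mass G * v by move=> ->; ring.
rewrite (ev p (m + q + q)) ?(ev m (p + m + q + q)) ?(ev q (m + q)); [|lin..].
by rewrite /len; split; ring.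
Qed.

Lemma mass_ge0 G : invariant_cdf G -> 0 <= mass G /\ forall i, (i < 4)%N -> 0 <= incr G i.
Proof.
move=> [mono _].
have incr0 i : (i < 4)%N -> 0 <= incr G i.
  move=> i4; rewrite /incr subr_ge0; have bi := brk_lt i4.
  have [b0 b1] := brk_piece i4.
  by apply: mono => //; exact: ltW.
split=> //; rewrite /mass; apply: addr_ge0.
  by apply: addr_ge0; [apply: mulr_ge0; [exact: ltW|]|]; exact: incr0.
by apply: mulr_ge0; [lin|apply: addr_ge0; exact: incr0].
Qed.

Lemma mass1_itv : 0 < mass1 /\ m * m * mass1 < 1.
Proof.
have m1 : m < 1 by lin. have p1 : p < 1 by lin. have q0 : 0 < q by lin.
have pq : 0 < p * q by rewrite mulr_gt0; lin.
have pm : 0 < p * (1 - m) by rewrite mulr_gt0; lin.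
have k1 : mass1 < 1 by rewrite /mass1; lin.
have pq' : 0 < (1 - p) * q by rewrite mulr_gt0; lin.
have k0 : 0 < mass1 by rewrite /mass1; lin.
split=> //; rewrite -[ltRHS](mulr1 1); apply: ltr_pM => //; first by rewrite mulr_ge0 ?ltW.
  by rewrite ltW.
by rewrite -[ltRHS](mulr1 1); apply: ltr_pM => //; rewrite ltW.
Qed.

(* M^2 > 0 makes the cone of possible increments shrink at a definite rate. *)
Lemma defect_ge n G i : invariant_cdf G -> (i < 4)%N ->
  - ((1 - m * m * mass1) ^+ n * (mass G * len i)) <= defect G i.
Proof.
elim: n G i => [|n IH] G i invG i4.
  have [L0 v0] := mass_ge0 invG.
  rewrite expr0 mul1r /defect lerBrDr addrC subrr.
  by rewrite mulr_ge0 ?v0// ltW//; have [] := mass1_itv.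
have invG1 := invariant_renorm invG; have invG2 := invariant_renorm invG1.
have [k0 k1] := mass1_itv.
have [L0 _] := mass_ge0 invG.
set e := (1 - m * m * mass1) ^+ n in IH *.
have e0 : 0 <= e by rewrite exprn_ge0// subr_ge0 ltW.
have := defect_renorm invG; have := defect_renorm invG1.
have w0 := IH _ 0%N invG2 isT; have w1 := IH _ 1%N invG2 isT.
have w2 := IH _ 2%N invG2 isT; have w3 := IH _ 3%N invG2 isT.
have Lw : m * defect (renorm (renorm G)) 0 + defect (renorm (renorm G)) 1
   + (1 - p) * (defect (renorm (renorm G)) 2 + defect (renorm (renorm G)) 3) = 0.
  by rewrite /defect /mass /mass1 /len; ring.
move: w0 w1 w2 w3 Lw; rewrite !mass_renorm//.
move: (defect (renorm (renorm G))) (defect (renorm G)) => w u.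
set X := e * mass G; have X0 : 0 <= X by rewrite mulr_ge0.
set E := m * m * X.
have EE l : e * (m * (m * mass G) * l) = E * l by rewrite /E /X; ring.
rewrite !EE /len => w0 w1 w2 w3 Lw [u0 u1 u2 u3] [v0 v1 v2 v3].
(* A row [(1, a, b, c)] dominates the left eigenvector [(m, 1, 1 - p, 1 - p)]. By [Lw] the latter
   can be subtracted at no cost; the smaller nonnegative coefficients improve the lower bound by
   [E * mass1]. *)
have row (l a b c v : R) : 0 <= l <= 1 -> m * m * (p + a * m + b * q + c * q) = l ->
    1 <= a -> 1 <= b -> 1 <= c -> v = w 0%N + a * w 1%N + b * w 2%N + c * w 3%N ->
    - ((1 - m * m * mass1) * e * (mass G * l)) <= v.
  move=> l01 lE a1 b1 c1 vE.
  have s0 : 0 <= (1 - m) * (w 0%N + E * p) by rewrite mulr_ge0; lin.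
  have s1 : 0 <= (a - 1) * (w 1%N + E * m) by rewrite mulr_ge0; lin.
  have s2 : 0 <= (b - (1 - p)) * (w 2%N + E * q) by rewrite mulr_ge0; lin.
  have s3 : 0 <= (c - (1 - p)) * (w 3%N + E * q) by rewrite mulr_ge0; lin.
  have -> : (1 - m * m * mass1) * e * (mass G * l) = X * l - X * (m * m * mass1) * l.
    by rewrite /X; ring.
  have El : X * l = E * (p + a * m + b * q + c * q) by rewrite -lE /E; ring.
  have EK : X * (m * m * mass1) * l <= E * mass1.
    have -> : E * mass1 = X * (m * m * mass1) by rewrite /E; ring.
    by rewrite ler_piMr//; [rewrite mulr_ge0// mulr_ge0// ltW|lra].
  have EKE : E * mass1 = E * (m * p + m + (1 - p) * (q + q)) by [].
  rewrite El vE; move: EK; rewrite EKE; move: (X * (m * m * mass1) * l) => Y.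
  by move: s0 s1 s2 s3 Lw; lra.
rewrite exprS -/e.
have q0 : 0 < q by lin.
have m2 x y z : m * x = y -> m * y = z -> m * m * x = z by rewrite -mulrA => -> ->.
(* The coefficients are the rows of the squared incidence matrix, whose first column consists of
   ones. *)
case: i i4 => [|[|[|[|//]]]] _ /=.
- by apply: (row p 3 2 2); try (apply: (m2 _ (m + 2 * q))); lin.
- by apply: (row m 4 3 3); try (apply: (m2 _ 1)); lin.
- by apply: (row q 2 2 1); try (apply: (m2 _ (m + q))); lin.
- by apply: (row q 2 1 2); try (apply: (m2 _ (m + q))); lin.
Qed.

(** In the limit all defects are nonnegative, and a combination of them with positive weights
    vanishes. *)
Lemma defect_eq0 G i : invariant_cdf G -> (i < 4)%N -> defect G i = 0.
Proof.
move=> invG; have [k0 k1] := mass1_itv.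
have t01 : 0 <= 1 - m * m * mass1 < 1.
  by have := mulr_gt0 mm0 k0; move: k1; lra.
have d0 j : (j < 4)%N -> 0 <= defect G j.
  move=> j4; rewrite -oppr_le0; apply: (geometric_le0 t01) => n.
  by rewrite lerNl; exact: defect_ge.
have sum0 : m * defect G 0 + defect G 1 + (1 - p) * (defect G 2 + defect G 3) = 0.
  by rewrite /defect /mass /mass1 /len; ring.
have d0' := d0 0%N isT; have d1 := d0 1%N isT.
have d2 := d0 2%N isT; have d3 := d0 3%N isT.
have p1 : 0 < 1 - p by lin.
have md0 : 0 <= m * defect G 0 by rewrite mulr_ge0// ltW.
have pd2 : 0 <= (1 - p) * defect G 2 by rewrite mulr_ge0// ltW.
have pd3 : 0 <= (1 - p) * defect G 3 by rewrite mulr_ge0// ltW.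
have cancel (u v : R) : 0 < u -> u * v = 0 -> v = 0.
  by move=> u0 /eqP; rewrite mulf_eq0 gt_eqF//= => /eqP.
case: i => [|[|[|[|//]]]] _.
- by apply: (cancel m) => //; lra.
- by lra.
- by apply: (cancel (1 - p)) => //; lra.
- by apply: (cancel (1 - p)) => //; lra.
Qed.

Lemma incrE G i : invariant_cdf G -> (i < 4)%N -> incr G i = (G 1 - G 0) * len i.
Proof.
move=> invG i4; have [k0 _] := mass1_itv.
have e j : (j < 4)%N -> mass1 * incr G j = mass G * len j.
  by move=> j4; apply/eqP; rewrite -subr_eq0; apply/eqP; exact: defect_eq0.
have tot : mass1 * (G 1 - G 0) = mass G.
  have -> : G 1 - G 0 = incr G 0 + incr G 1 + incr G 2 + incr G 3.
    by rewrite /incr /=; ring.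
  have := e 0%N isT; have := e 1%N isT; have := e 2%N isT; have := e 3%N isT.
  have : mass G * (p + m + 2 * q) = mass G by rewrite sumE mulr1.
  by rewrite /len; lra.
apply: (mulfI (lt0r_neq0 k0)); rewrite e// mulrA tot //.
Qed.

(** The row of piece 1 in the incidence matrix consists of ones, so the total for [renorm G] is the
    increment of [G] over a piece of length [m]. *)
Lemma total_renorm G : invariant_cdf G ->
  renorm G 1 - renorm G 0 = m * (G 1 - G 0).
Proof.
move=> invG; have [_ e _ _] := incr_renorm invG.
have := incrE invG (isT : (1 < 4)%N); rewrite e /incr /= => e1.
by rewrite mulrC -e1 /incr /=; ring.
Qed.

(** * Linearity of invariant distribution functions *)

Definition err (G : R -> R) (x : R) : R := G x - G 0 - (G 1 - G 0) * x.

Lemma floor_err G i j c s x y : invariant_cdf G -> floor i j c s -> cp j x -> cp j y ->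
  err G (c + s * (m * y)) - err G (c + s * (m * x))
  = s * (err (renorm G) y - err (renorm G) x).
Proof.
move=> invG fl jx jy; have [/(_ _ _ _ fl) e _] := floor_top invG (floor_lt fl) jx jy.
rewrite /err total_renorm//.
have -> : s * (renorm G y - renorm G 0 - m * (G 1 - G 0) * y -
    (renorm G x - renorm G 0 - m * (G 1 - G 0) * x))
  = s * (renorm G y - renorm G x) - s * (m * (G 1 - G 0) * (y - x)) by ring.
by rewrite -e; ring.
Qed.

Lemma err_brk G i : invariant_cdf G -> (i <= 4)%N -> err G (brk i) = 0.
Proof.
move=> invG; elim: i => [|i IH] i4; first by rewrite /err /=; ring.
have := incrE invG i4; have {IH} := IH (ltnW i4).
have -> : len i = brk i.+1 - brk i.
  by case: i i4 => [|[|[|[|//]]]] _; rewrite /len /=; lin.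
by rewrite /err /incr; lra.
Qed.

(** Both ends of a floor have equal errors, because the error of [renorm G] vanishes at breakpoints;
    chains of adjacent floors then link each end to a breakpoint. *)
Lemma floor_end_err G i j c s : invariant_cdf G -> floor i j c s ->
  err G (c + s * (m * brk j)) = 0.
Proof.
move=> invG; have invG1 := invariant_renorm invG.
have ends i' j' c' s' a b : floor i' j' c' s' -> a = c' + s' * (m * brk j') ->
    b = c' + s' * (m * brk j'.+1) -> err G a = err G b.
  move=> fl -> ->; have j4 := floor_lt fl; have lt_j := brk_lt j4.
  apply/eqP; rewrite -subr_eq0 (floor_err invG fl) ?lexx ?ltW//.
  by rewrite !err_brk ?subrr ?mulr0// ltnW.
have e4 : err G 1 = 0 := err_brk invG (leqnn 4).
have z0 : err G 0 = 0 := @err_brk G 0 invG isT.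
have z1 : err G p = 0 := @err_brk G 1 invG isT.
have z2 : err G (p + m) = 0 := @err_brk G 2 invG isT.
have z3 : err G (p + m + q) = 0 := @err_brk G 3 invG isT.
pose e1 := q + m - p - m * (p + m); pose e2 := q + m - m * (p + m).
pose e3 := q + m - m * p; pose e6 := q + m + 1 - 2 * p - m * p.
have f02 : err G e1 = err G 0 by apply: ends Floor02 _ _; rewrite /e1 /=; lin.
have f01 : err G q = err G e1 by apply: ends Floor01 _ _; rewrite /e1 /=; lin.
have f12 : err G e2 = err G p by apply: ends Floor12 _ _; rewrite /e2 /=; lin.
have f11 : err G e3 = err G e2 by apply: ends Floor11 _ _; rewrite /e3 /e2 /=; lin.
have f10 : err G (q + m) = err G e3 by apply: ends Floor10 _ _; rewrite /e3 /=; lin.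
have f31 : err G e6 = err G (p + m + q) by apply: ends Floor31 _ _; rewrite /e6 /=; lin.
have at_ u v : err G v = 0 -> u = v -> err G u = 0 by move=> ? ->.
have z4 := etrans f02 z0; have z5 := etrans f01 z4; have z6 := etrans f12 z1.
have z7 := etrans f11 z6; have z8 := etrans f10 z7; have z9 := etrans f31 z3.
case.
- by apply: at_ z4 _; rewrite /e1 /e2 /e3 /e6 /=; lin.
- by apply: at_ z5 _; rewrite /e1 /e2 /e3 /e6 /=; lin.
- by apply: at_ z1 _; rewrite /e1 /e2 /e3 /e6 /=; lin.
- by apply: at_ z6 _; rewrite /e1 /e2 /e3 /e6 /=; lin.
- by apply: at_ z7 _; rewrite /e1 /e2 /e3 /e6 /=; lin.
- by apply: at_ z8 _; rewrite /e1 /e2 /e3 /e6 /=; lin.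
- by apply: at_ z8 _; rewrite /e1 /e2 /e3 /e6 /=; lin.
- by apply: at_ z2 _; rewrite /e1 /e2 /e3 /e6 /=; lin.
- by apply: at_ z3 _; rewrite /e1 /e2 /e3 /e6 /=; lin.
- by apply: at_ z9 _; rewrite /e1 /e2 /e3 /e6 /=; lin.
- by apply: at_ e4 _; rewrite /e1 /e2 /e3 /e6 /=; lin.
Qed.

(** Measured from an end of the floor containing [x], the error of [G] is up to sign an error of
    [renorm G], whose total increment is [m] times that of [G]. *)
Lemma err_bound n G x : invariant_cdf G -> 0 <= x <= 1 ->
  `|err G x| <= m ^+ n * (G 1 - G 0).
Proof.
elim: n G x => [|n IH] G x invG x01.
  have [mono _] := invG; rewrite expr0 mul1r /err.
  have [x0 x1] := andP x01.
  have l := mono 0 x (lexx 0) x0 x1; have u := mono x 1 x0 x1 (lexx 1).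
  have V0 : 0 <= G 1 - G 0 by lra.
  have Vx0 : 0 <= (G 1 - G 0) * x by rewrite mulr_ge0.
  have Vx1 : (G 1 - G 0) * x <= G 1 - G 0 by rewrite ler_piMr.
  by rewrite ler_norml; move: (_ * x) Vx0 Vx1 => *; lra.
have [i i4 /(floor_cover i4)[j [c [s [z [fl jz ->]]]]]] := cp_cover x01.
have j4 := floor_lt fl; have lt_j := brk_lt j4.
have invG1 := invariant_renorm invG.
have -> : err G (c + s * (m * z))
    = err G (c + s * (m * z)) - err G (c + s * (m * brk j)).
  by rewrite (floor_end_err invG fl) subr0.
rewrite (floor_err invG fl) ?lexx ?(ltW lt_j)//.
rewrite (err_brk invG1 (ltnW j4)) subr0 normrM.
have -> : `|s| = 1 by apply/eqP; rewrite -sqrp_eq1// -normrX expr2 (floor_sign fl) normr1.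
rewrite mul1r exprSr -mulrA -(total_renorm invG); apply: (IH (renorm G) z) => //.
have [b0 b1] := brk_piece j4.
by move/andP: jz => [z0 z1]; rewrite (le_trans b0)//= (le_trans z1).
Qed.

Lemma invariant_cdf_linear G x : invariant_cdf G -> 0 <= x <= 1 ->
  G x = G 0 + (G 1 - G 0) * x.
Proof.
move=> invG x01; have m01 : 0 <= m < 1 by lin.
have : `|err G x| <= 0.
  by apply: (geometric_le0 m01) => n; exact: err_bound.
by rewrite normr_le0 /err => /eqP; lra.
Qed.

(** * Unique ergodicity *)

Local Notation RT := (measurableTypeR R).
Local Notation branch i := (fun x : RT => slope i * x + offset i : RT).

Lemma measurable_piece i : measurable (iet_piece brk i : set RT).
Proof. exact: measurable_itv. Qed.

Lemma measurable_dom : measurable (D : set RT).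
Proof. by apply: bigcup_measurable => i _; exact: measurable_piece. Qed.

Lemma piece_uniq i j x : (i < 4)%N -> (j < 4)%N -> op i x -> op j x -> i = j.
Proof.
by case: i => [|[|[|[|//]]]] _; case: j => [|[|[|[|//]]]] _ //= ix jx; exfalso; lin.
Qed.

Lemma dom_preimageE (A : set R) : D `&` T @^-1` A =
  \bigcup_(i in `I_4) (iet_piece brk i `&` branch i @^-1` A).
Proof.
apply/seteqP; split=> x.
  move=> [[i i4 ix]]; exists i => //; split=> //=.
  by rewrite iet_pieceE in ix; rewrite -TE.
move=> [i i4 [ix]] /= Ax; split; first by exists i.
by rewrite iet_pieceE in ix; rewrite /= (TE i4 ix).
Qed.

(** Each branch is an isometry onto [J i], and the disjoint sets [J i] fill [[0, 1]] up to five
    points. *)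
Lemma T_lebesgue_invariant : iet_invariant 4 1 brk T (leb_on 1).
Proof.
move=> A mA; rewrite /leb_on dom_preimageE.
pose inv i (y : RT) : RT := slope i * y + - (slope i * offset i).
have invK i x : inv i (branch i x) = x.
  by rewrite /inv mulrDr mulrA slope_sq mul1r addrK.
have Kinv i x : branch i (inv i x) = x.
  by rewrite /inv mulrDr mulrA slope_sq mul1r mulrN mulrA slope_sq mul1r subrK.
pose J i : set RT := inv i @^-1` iet_piece brk i.
have mJ i : measurable (J i).
  by apply: measurable_affine_preimage; exact: measurable_piece.
have JT i y : (i < 4)%N -> J i y -> exists2 x, op i x & T x = y.
  move=> i4; rewrite /J /= iet_pieceE => iy; exists (inv i y) => //.
  by rewrite (TE i4 iy); exact: Kinv.
have pieceE i : iet_piece brk i `&` branch i @^-1` A = branch i @^-1` (J i `&` A).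
  by rewrite preimage_setI; congr (_ `&` _); apply/seteqP; split=> x; rewrite /J /= invK.
have triv : trivIset `I_4 (fun i => J i `&` A).
  move=> i j /= i4 j4 [y [[Ji _] [Jj _]]].
  have [x ix xy] := JT i y i4 Ji; have [x' jx xy'] := JT j y j4 Jj.
  apply: (piece_uniq i4 j4 ix); rewrite (_ : x = x')//.
  by apply: T_inj; rewrite ?inE ?xy ?xy'//; [exact: domI ix|exact: domI jx].
have mJA i : measurable (J i `&` A) by exact: measurableI.
have -> : (\bigcup_(i in `I_4) (iet_piece brk i `&` branch i @^-1` A)) `&` `[0, 1]
    = \bigcup_(i in `I_4) (branch i @^-1` (J i `&` A)).
  under eq_bigcupr do rewrite pieceE.
  apply/setIidPl => x [i i4]; rewrite -pieceE => -[]; rewrite iet_pieceE => ix _.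
  by have := dom_itv (domI i4 ix); rewrite /= in_itv /=; lra.
have split_A : A `&` `[0, 1] = (\bigcup_(i in `I_4) (J i `&` A)) `|`
    ((A `&` `[0, 1]) `\` \bigcup_(i in `I_4) (J i `&` A)).
  rewrite setDE setUIr setUv setIT setUidr// => y [i i4 [Jy Ay]]; split=> //.
  have [x ix <-] := JT i y i4 Jy.
  by have := T_itv (domI i4 ix); rewrite /= in_itv /=; lra.
have mU : measurable (\bigcup_(i in `I_4) (J i `&` A)).
  by apply: bigcup_measurable => i _.
have mA1 : measurable (A `&` `[0, 1]) by apply: measurableI => //; exact: measurable_itv.
rewrite [X in _ = lebesgue_measure X]split_A measureU0//; last 2 first.
- exact: measurableD.
- apply: countable_lebesgue_measure0; apply: finite_set_countable.
  apply: (@sub_finite_set _ _ [set 0; m; m + q; m + 2 * q; 1]) => //.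
  move=> y [[Ay]]; rewrite /= in_itv /= => y01 nJ.
  apply: contrapT => yN; apply: nJ.
  have [||||x Dx xy] := @preimage y.
  + have y0 : y != 0 by apply/eqP => ?; apply: yN => /=; tauto.
    have y1 : y != 1 by apply/eqP => ?; apply: yN => /=; tauto.
    by move: y0 y1 y01; rewrite !neq_lt; lra.
  + by move=> ?; apply: yN => /=; tauto.
  + by move=> ?; apply: yN => /=; tauto.
  + by move=> ?; apply: yN => /=; tauto.
  have [i i4 ix] := domP Dx; exists i => //; split=> //.
  by rewrite /J /= -xy (TE i4 ix) invK iet_pieceE.
have mf i : measurable (branch i @^-1` (J i `&` A)) by exact: measurable_affine_preimage.
rewrite !measure_fin_bigcup//; last first.
  move=> i j i4 j4 [x []]; rewrite -!pieceE => -[ix _] [jx _].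
  by rewrite !iet_pieceE in ix jx; exact: piece_uniq ix jx.
apply: eq_fsbigr => i _; apply: lebesgue_measure_isometry => //; exact: slope_sq.
Qed.

Section UniqueErgodicity.
Variable mu : {measure set RT -> \bar R}.
Hypotheses (mu_fin : (mu setT < +oo)%E) (mu_out : mu (~` `[0, 1]) = 0%E).
Hypothesis mu_inv : iet_invariant 4 1 brk T mu.

Let M (A : set RT) : R := fine (mu A).

Let muE (A : set RT) : measurable A -> mu A = (M A)%:E.
Proof.
move=> mA; rewrite /M fineK// ge0_fin_numE//.
by apply: le_lt_trans mu_fin; apply: le_measure; rewrite ?inE.
Qed.

Let M_ge0 (A : set RT) : 0 <= M A.
Proof. exact/fine_ge0/measure_ge0. Qed.

Let MU (A B : set RT) : measurable A -> measurable B -> A `&` B = set0 ->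
  M (A `|` B) = M A + M B.
Proof.
move=> mA mB AB; apply: EFin_inj; rewrite -muE; last exact: measurableU.
by rewrite EFinD -!muE// measureU.
Qed.

Let M_null (A B : set RT) : measurable A -> measurable B -> A `<=` B -> M B = 0 -> M A = 0.
Proof.
move=> mA mB AB B0; apply: EFin_inj; rewrite -muE//.
have B0' : mu B = 0%E by rewrite muE// B0.
exact: (subset_measure0 mA mB AB B0').
Qed.

Let M_inv (A : set RT) : measurable A -> M (D `&` T @^-1` A) = M A.
Proof. by move=> mA; rewrite /M mu_inv. Qed.

(** Invariance applied to the whole line gives the domain full mass. *)
Let M_notdom x : ~ D x -> M [set x] = 0.
Proof.
move=> nDx; have mD : measurable (~` D : set RT) by apply: measurableC; exact: measurable_dom.
apply: (M_null _ mD) => //; first by move=> _ ->.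
have := M_inv measurableT; rewrite preimage_setT setIT => MD.
have := MU measurable_dom mD (setICr _); rewrite setUv MD; lra.
Qed.

Let M_notim x : (forall y, D y -> T y <> x) -> M [set x] = 0.
Proof.
move=> nT; rewrite -M_inv// (_ : _ `&` _ = set0) /M ?measure0//.
by apply/seteqP; split=> // y [Dy] /= /(nT y Dy).
Qed.

Let end_notim i y : (i < 4)%N -> D y -> T y <> slope i * brk i + offset i /\
  T y <> slope i * brk i.+1 + offset i.
Proof.
by move=> i4 /domT Dy; case: i i4 => [|[|[|[|//]]]] _; rewrite /slope /=;
  case: Dy => -[iy ->]; lin.
Qed.

(** Inside a piece this is invariance. At an end both points are null: one is outside the domain,
    the other outside the image. *)
Let M_point i x : (i < 4)%N -> cp i x -> M [set slope i * x + offset i] = M [set x].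
Proof.
move=> i4 ix.
have end_null b : (b = brk i \/ b = brk i.+1) ->
    M [set b] = 0 /\ M [set slope i * b + offset i] = 0.
  move=> bE; split.
    apply: M_notdom => /domP[j j4 jb].
    by case: bE jb => ->; case: i j i4 j4 {ix} => [|[|[|[|//]]]] [|[|[|[|//]]]] _ _ /=; lin.
  by apply: M_notim => y Dy; have [e1 e2] := end_notim i4 Dy; case: bE => ->.
have [xb|xb] := eqVneq x (brk i); first by have [-> ->] := end_null x (or_introl xb).
have [xb'|xb'] := eqVneq x (brk i.+1); first by have [-> ->] := end_null x (or_intror xb').
have ox : op i x by rewrite !lt_neqAle eq_sym xb xb'.
rewrite -TE// -[in LHS]M_inv//; congr M; apply/seteqP; split=> [y [Dy /= Ty]|_ ->] /=.
  by apply: T_inj; rewrite ?inE//; exact: domI ox.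
by split=> //; exact: domI ox.
Qed.

Let M_open i x y : (i < 4)%N -> cp i x -> cp i y -> x < y ->
  M (branch i @` `]x, y[) = M `]x, y[%classic.
Proof.
move=> i4 ix iy xy.
have sub z : x < z < y -> op i z by lra.
have mimg : measurable (branch i @` `]x, y[ : set RT).
  rewrite (_ : _ @` _ = (fun z : RT => slope i * z + - (slope i * offset i) : RT) @^-1` `]x, y[).
    by apply: measurable_affine_preimage; exact: measurable_itv.
  apply/seteqP; split=> [_ [z zxy <-]|z zxy] /=.
    by rewrite mulrDr mulrA slope_sq mul1r addrK.
  exists (slope i * z + - (slope i * offset i)) => //.
  by rewrite mulrDr mulrA slope_sq mul1r mulrN mulrA slope_sq mul1r subrK.
rewrite -M_inv//; congr M; apply/seteqP; split=> z.
  move=> [Dz [w]]; rewrite /= in_itv /= => wxy; rewrite -(TE i4 (sub _ wxy)) => Twz.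
  suff <- : w = z by rewrite in_itv.
  by apply: T_inj; rewrite ?inE//; exact: domI (sub _ wxy).
rewrite /= in_itv /= => zxy; split; first exact: domI (sub _ zxy).
by exists z; [rewrite /= in_itv|rewrite (TE i4 (sub _ zxy))].
Qed.

Let M_ray z : M `]-oo, z]%classic = M `]-oo, z[%classic + M [set z].
Proof.
rewrite -MU//; last first.
  by apply/seteqP; split=> // w []; rewrite /= in_itv /= => + wz; rewrite wz ltxx.
congr M; apply/seteqP; split=> w; rewrite /= !in_itv /= le_eqVlt.
  by move=> /orP[/eqP|]; auto.
by move=> [->|->]; rewrite ?eqxx ?orbT.
Qed.

(** Twice the symmetrized distribution function: an atom counts equally on both sides, so a flip,
    which swaps the sides, only changes the sign of increments. *)
Let G (x : R) : R := M `]-oo, x[%classic + M `]-oo, x]%classic.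

Let G_diff x y : x < y ->
  G y - G x = 2 * M `]x, y[%classic + M [set x] + M [set y].
Proof.
move=> xy.
have c2 : M `]-oo, y[%classic = M `]-oo, x]%classic + M `]x, y[%classic.
  rewrite -MU//; last first.
    by apply/seteqP; split=> // w []; rewrite /= !in_itv /=; lra.
  congr M; apply/seteqP; split=> w; rewrite /= !in_itv /=; last by case; lra.
  by case: (leP w x) => ?; [left|right]; lra.
by rewrite /G !M_ray c2 M_ray; ring.
Qed.

Let G_invariant : invariant_cdf G.
Proof.
have mono x y : x <= y -> G x <= G y.
  rewrite le_eqVlt => /orP[/eqP->//|xy]; rewrite -subr_ge0 G_diff//.
  by rewrite !addr_ge0 ?mulr_ge0.
split=> [x y _ xy _|i x y i4 ix iy]; first exact: mono.
wlog xy : x y ix iy / x < y.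
  move=> w; have [xy|yx|->] := ltgtP x y; first exact: w.
  - by rewrite -[LHS]opprB w// -mulrN opprB.
  - by rewrite !subrr mulr0.
rewrite [in RHS]G_diff// -(M_point i4 ix) -(M_point i4 iy) -(M_open i4 ix iy xy).
have [si|si] : slope i = 1 \/ slope i = - 1 by rewrite /slope; case: ifP; auto.
  have img : branch i @` `]x, y[
      = `]slope i * x + offset i, slope i * y + offset i[%classic.
    apply/seteqP; split=> [_ [z + <-]|z]; rewrite /= !in_itv /= si; first by lra.
    by move=> zxy; exists (z - offset i); [rewrite /= in_itv /=; lra|ring].
  by rewrite img G_diff ?si ?mul1r//; lra.
have img : branch i @` `]x, y[
    = `]slope i * y + offset i, slope i * x + offset i[%classic.
  apply/seteqP; split=> [_ [z + <-]|z]; rewrite /= !in_itv /= si; first by lra.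
  by move=> zxy; exists (offset i - z); [rewrite /= in_itv /=; lra|ring].
rewrite -[LHS]opprB img G_diff; last by rewrite si; lra.
by rewrite [X in _ = X * _]si; ring.
Qed.

Let G_linear x : 0 <= x <= 1 -> G x = (G 1 - G 0) * x.
Proof.
move=> x01; rewrite (invariant_cdf_linear G_invariant x01) [X in X + _](_ : _ = 0) ?add0r//.
have M0 : M `]-oo, 0[%classic = 0.
  apply: (@M_null _ (~` `[0, 1])) => //; last by rewrite /M mu_out.
    by apply: measurableC; exact: measurable_itv.
  by move=> y; rewrite /= !in_itv /=; lra.
by rewrite /G M_ray M0 M_notdom ?addr0// => /dom_itv; lra.
Qed.

Let no_atom x : 0 <= x <= 1 -> M [set x] = 0.
Proof.
move=> x01; have [->|x0] := eqVneq x 0; first by apply: M_notdom => /dom_itv; lra.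
have {}x0 : 0 < x by rewrite lt_neqAle eq_sym x0; case/andP: x01.
apply/eqP; rewrite eq_le M_ge0 andbT.
have half : 0 <= (2^-1 : R) < 1 by lra.
apply: (geometric_le0 (c := (G 1 - G 0) * x) half) => n.
have e0 : 0 < 2^-1 ^+ n :> R by rewrite exprn_gt0//; lra.
have e1 : 2^-1 ^+ n <= 1 :> R by rewrite exprn_ile1//; lra.
(* The increment of [G] from [x - e * x] to [x] bounds the atom at [x], and by linearity it is
   proportional to [e]. *)
move: (2^-1 ^+ n) e0 e1 => e e0 e1.
have ex0 : 0 < e * x by rewrite mulr_gt0.
have ex1 : e * x <= x by rewrite ler_piMl// ltW.
have yx : x - e * x < x by lra.
have yx01 : 0 <= x - e * x <= 1 by lra.
have := G_diff yx; rewrite (G_linear x01) (G_linear yx01).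
have := M_ge0 [set x - e * x]; have := M_ge0 `]x - e * x, x[%classic.
have -> : (G 1 - G 0) * x - (G 1 - G 0) * (x - e * x) = e * ((G 1 - G 0) * x) by ring.
by move=> a b ->; lra.
Qed.

(** The distribution function of Lebesgue measure on [[0, 1]]. *)
Definition clamp (x : R) : R := Num.max 0 (Num.min 1 x).

Lemma invariant_measure_itv a b : a < b ->
  mu `]a, b]%classic = (fine (mu setT) * (clamp b - clamp a))%:E.
Proof.
have itv_null (i : interval R) : (forall y, y \in i -> ~~ (0 <= y <= 1)) -> M [set` i] = 0.
  move=> out; apply: (@M_null _ (~` `[0, 1])) => //; last by rewrite /M mu_out.
  - by apply: measurableC; exact: measurable_itv.
  - by move=> y /= yi; rewrite in_itv /=; apply/negP/out.
have M_oc x y : x <= y -> M `]-oo, y]%classic = M `]-oo, x]%classic + M `]x, y]%classic.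
  move=> xy; rewrite -MU//; last first.
    by apply/seteqP; split=> // w []; rewrite /= !in_itv /=; lra.
  congr M; apply/seteqP; split=> w; rewrite /= !in_itv /=.
    by case: (leP w x) => ?; [left|right].
  by move=> []; lra.
have ray x : 0 <= x <= 1 -> M `]-oo, x]%classic = (G 1 - G 0) / 2 * x.
  move=> x01; have := G_linear x01; have := M_ray x; rewrite no_atom// /G => -> ?.
  by lra.
have total : M setT = (G 1 - G 0) / 2.
  rewrite -[RHS]mulr1 -ray; last by lra.
  rewrite (_ : setT = `]-oo, 1]%classic `|` `]1, +oo[%classic) ?MU//.
  - by rewrite (itv_null `]1, +oo[) ?addr0// => y; rewrite in_itv /=; lra.
  - by apply/seteqP; split=> // w []; rewrite /= !in_itv /=; lra.
  - apply/seteqP; split=> w //= _; rewrite !in_itv /= andbT.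
    by case: (leP w 1) => ?; [left|right].
have clampE x : M `]-oo, x]%classic = M setT * clamp x.
  rewrite total /clamp; have [x1|x1] := leP 1 x.
    rewrite (M_oc 1 x x1) ray ?(itv_null `]1, x]) ?addr0 ?max_r//; try lra.
    by move=> y; rewrite in_itv /=; lra.
  have [x0|x0] := leP 0 x; first by rewrite ray//; lra.
  by rewrite mulr0; apply: itv_null => y; rewrite in_itv /=; lra.
move=> ab; rewrite muE//; congr EFin.
by rewrite mulrBr -/(M _) -!clampE (M_oc a b (ltW ab)); ring.
Qed.

End UniqueErgodicity.

Lemma T_uniquely_ergodic : iet_uniquely_ergodic 4 1 brk T.
Proof.
split; first exact: T_lebesgue_invariant.
move=> mu mu_fin mu_out mu_inv.
have mI : measurable (`[0, 1]%classic : set RT) by exact: measurable_itv.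
have c0 : 0 <= fine (mu setT) by exact/fine_ge0/measure_ge0.
exists (fine (mu setT)); split=> // A mA.
have leb1 : lebesgue_measure (`[0, 1]%classic : set RT) = 1%E.
  by rewrite lebesgue_measure_itv /= lte_fin ltr01 oppr0 adde0.
pose leb := mrestr lebesgue_measure mI : {measure set RT -> \bar R}.
have lebT : leb setT = 1%E by rewrite /leb /= /mrestr setTI.
(* Restricted Lebesgue measure is itself invariant, of total mass 1, so the formula for invariant
   measures computes it too. *)
have leb_itv a b : a < b -> leb `]a, b]%classic = (clamp b - clamp a)%:E.
  move=> ab; rewrite (invariant_measure_itv (mu := leb)) ?lebT ?mul1r ?ltry//.
  - by rewrite /leb /= /mrestr setICl measure0.
  - exact: T_lebesgue_invariant.
rewrite -[RHS]/(mscale (NngNum c0) leb A).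
apply: finite_measure_ext => // a b ab.
by rewrite (invariant_measure_itv mu_fin mu_out mu_inv ab) EFinM -leb_itv.
Qed.

End Example.

(** * Choice of the lengths and conclusion *)

Lemma scaling_factor (R : realType) :
  exists2 m : R, 0 < m < 1 & m * m * m + 2 * (m * m) + 2 * m = 1.
Proof.
pose P : {poly R} := 'X^3 + 2%:P * 'X^2 + 2%:P * 'X - 1%:P.
have PE x : P.[x] = x * x * x + 2 * (x * x) + 2 * x - 1.
  by rewrite /P !hornerE; ring.
have [|x x01 /rootP] := @poly_ivt R P 0 1 ler01; first by rewrite !PE; lra.
rewrite PE => Px; exists x; last by lra.
have x0 : x != 0 by apply/eqP => x0; move: Px; rewrite x0; lra.
have x1 : x != 1 by apply/eqP => x1; move: Px; rewrite x1; lra.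
by move: x01; rewrite !le_eqVlt eq_sym (negPf x0) (negPf x1).
Qed.

Theorem theorem6p1 (R : realType) :
  (exists (l : R) (a : nat -> R) (T : R -> R),
     [/\ is_IET 4 l a T, iet_nflips 4 a T = 2%N,
         iet_minimal 4 l a T & iet_uniquely_ergodic 4 l a T])
  /\ IET_class R 4 2 /\ CET_class R 3 2.
Proof.
have [m /andP[m0 m1] mroot] := scaling_factor R.
have mp1 : 0 < 1 + m by lra.
have mn1 : 0 < 1 - m by lra.
(* These solve [q = m * m + m * q] and [m = m * p + p], the latter being what [mE] and [pE] give
   together. *)
pose p := m / (1 + m); pose q := m * m / (1 - m).
have hp : p * (1 + m) = m by rewrite /p divfK// gt_eqF.
have hq : q * (1 - m) = m * m by rewrite /q divfK// gt_eqF.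
have p0 : 0 < p by rewrite divr_gt0.
have q0 : 0 < q by rewrite divr_gt0 ?mulr_gt0.
move: p q hp hq p0 q0 => p q hp hq p0 q0.
have mm0 : 0 < m * m by rewrite mulr_gt0.
have mp0 : 0 < m * p by rewrite mulr_gt0.
have mq0 : 0 < m * q by rewrite mulr_gt0.
have qE : q = m * m + m * q by lra.
have sumE : p + m + 2 * q = 1.
  have nz : (1 + m) * (1 - m) != 0 by rewrite mulf_neq0 ?gt_eqF.
  (* Cleared of denominators, the relation is the cubic equation of [m]. *)
  apply: (mulfI nz); rewrite mulr1.
  transitivity (p * (1 + m) * (1 - m) + m * (1 + m) * (1 - m)
    + 2 * (q * (1 - m)) * (1 + m)); first by ring.
  by rewrite hp hq; lra.
have pE : p = m * m + 2 * (m * q).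
  have : m * (p + m + 2 * q) = m by rewrite sumE mulr1.
  by lra.
have mE : m = m * p + m * m + 2 * (m * q) by lra.
have iet : is_IET 4 1 (brk m p q) (T m p q) by apply: T_IET.
have flips : iet_nflips 4 (brk m p q) (T m p q) = 2%N by apply: T_nflips.
have minimal : iet_minimal 4 1 (brk m p q) (T m p q) by apply: T_minimal.
split; last split.
- exists 1, (brk m p q), (T m p q); split=> //.
  by apply: T_uniquely_ergodic.
- by exists 1, (brk m p q), (T m p q); split=> //; case: minimal.
- exists (arc m p q), (T m p q); split.
  + by apply: T_CET.
  + by apply: T_cet_nflips.
  + by apply: T_cet_transitive.
Qed.
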